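(* Let $(V_i)_{i\ge0}$, $(A_i)_{i\ge0}$, $(B_i)_{i\ge0}$ be mutually independent sequences of i.i.d. random variables with generic copies $V,A,B$, where $A,B\ge 0$. Put $Y_i=B_i-A_i$ with generic copy $Y$, and assume $\mathbb{E}|V|<\infty$ and $\mathbb{E}|Y|<\infty$. Let $W_0=w\ge 0$, $W_{i+1}=[V_iW_i+Y_i]^+$ and $W_i^\ast=[V_iW_i+Y_i]^-$ for $i=0,1,\dots$. Suppose that $V<0$ a.s. and that $B$ has a rational Laplace–Stieltjes transform $\Phi_B(s)=N_B(s)/D_B(s)$, where $D_B(s)=\prod_{j=1}^{\ell}(s-s_j)$ with $\mathrm{Re}\,s_j<0$ for $j=1,\dots,\ell$, and $N_B$ is a polynomial of degree at most $\ell-1$ sharing no zeros with $D_B$. Then, for $r\in(0,1)$, $$U_W(r,s)=e^{-sw}+\frac{\sum_{k=0}^{\ell}a_k(r)s^k}{D_B(s)},\qquad \mathrm{Re}\,s\ge 0,$$ $$U_{W^\ast}(r,s)=\frac{1}{1-r}-\frac{\sum_{k=0}^{\ell}a_k(r)s^k}{r\,D_B(s)}+\Phi_Y(s)\int_{-\infty}^{0}U_W(r,sy)\,\mathbb{P}(V\in \mathrm{d}y),\qquad \mathrm{Re}\,s\le 0,$$ where $$a_0(r)=\frac{r}{1-r}(-1)^\ell\prod_{j=1}^{\ell}s_j,$$ and the remaining constants $a_1(r),\dots,a_\ell(r)$ can be determined from the following system of $\ell$ linear equations: for $j=1,\dots,\ell$, $$\sum_{k=0}^{\ell}a_k(r)s_j^k\left(1-r\,N_B(s_j)\,\Phi_A(-s_j)\int_{-\infty}^{0}\frac{y^k}{\prod_{m=1}^{\ell}(s_jy-s_m)}\,\mathbb{P}(V\in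 \mathrm{d}y)\right)=r\,N_B(s_j)\,\Phi_A(-s_j)\,\Phi_V(s_jw).$$
   Context: Notation: $[x]^+=\max\{x,0\}$, $[x]^-=\min\{x,0\}$. $\Phi_X(s)=\mathbb{E}e^{-sX}$ wherever the expectation is defined. For a sequence $(X_i)_{i\ge0}$ of random variables, $U_X(r,s)=\sum_{i=0}^\infty r^i\Phi_{X_i}(s)$; $U_W$ and $U_{W^\ast}$ are formed from $(W_i)$ and $(W_i^\ast)$. $\Phi_Y(s)=\Phi_B(s)\Phi_A(-s)$, where for $\mathrm{Re}\,s\le 0$ the transform $\Phi_B(s)$ is read as the rational function $N_B(s)/D_B(s)$. Here $\Phi_V(s_jw)=\int_{-\infty}^0 e^{-s_jwy}\,\mathbb{P}(V\in \mathrm{d}y)$.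
   Formalization: The a_k satisfy the system in all cases, but are claimed to be determined by it only for pairwise distinct s_j (with repeated s_j the equations coincide); at s = s_j, where D_B vanishes, the second formula is read as a limit. *)

(* Defs.v *)
From HB Require Import structures.
From mathcomp Require Import all_boot all_order all_algebra.
From mathcomp Require Import complex.
From mathcomp Require Import all_classical all_reals all_analysis.

Set Implicit Arguments.
Unset Strict Implicit.
Unset Printing Implicit Defensive.

Import Order.TTheory GRing.Theory Num.Theory.
Import numFieldNormedType.Exports.

Local Open Scope classical_set_scope.
Local Open Scope complex_scope.
Local Open Scope ring_scope.

Definition cexp (R : realType) (z : R[i]) : R[i] :=
  (expR (complex.Re z))%:C * (cos (complex.Im z) +i* sin (complex.Im z)).

Definition cintegral (d : measure_display) (T : measurableType d) (R : realType)
    (mu : {measure set T -> \bar R}) (D : set T) (f : T -> R[i]) : R[i] :=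
  (\int[mu]_(x in D) complex.Re (f x)) +i* (\int[mu]_(x in D) complex.Im (f x)).

Section Model.
Context (d : measure_display) (T : measurableType d) (R : realType)
  (P : probability T R).

Definition mutually_independent (I : eqType) (X : I -> {RV P >-> R}) : Prop :=
  forall (J : seq I) (E : I -> set R), uniq J -> (forall i, measurable (E i)) ->
    P (\bigcap_(i in [set` J]) (X i @^-1` E i)) =
    (\prod_(i <- J) P (X i @^-1` E i))%E.

(* The member of index 0 serves as the generic copy. *)
Definition identically_distributed (X : nat -> {RV P >-> R}) : Prop :=
  forall (n : nat) (E : set R), measurable E ->
    distribution P (X n) E = distribution P (X 0%N) E.

(* Independence of this single family is mutual independence of the three
   sequences together with independence within each of them. *)
Definition inputs (V A B : nat -> {RV P >-> R}) (k : nat + nat + nat) :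
    {RV P >-> R} :=
  match k with
  | inl (inl n) => V n
  | inl (inr n) => A n
  | inr n => B n
  end.

Definition LST (X : T -> R) (s : R[i]) : R[i] :=
  cintegral P setT (fun t => cexp (- (s * (X t)%:C))).

Definition U (X : nat -> T -> R) (r : R) (s : R[i]) : R[i] :=
  limn (series (fun i => r%:C ^+ i * LST (X i) s) : nat -> R[i]^o).

Section Recursion.
Variables (w : R) (V A B : nat -> T -> R).

Fixpoint W (i : nat) : T -> R :=
  match i with
  | 0 => fun=> w
  | n.+1 => fun t => Num.max (V n t * W n t + (B n t - A n t)) 0
  end.

Definition Wstar (i : nat) : T -> R :=
  fun t => Num.min (V i t * W i t + (B i t - A i t)) 0.

End Recursion.

Section Transforms.
Variables (l : nat) (N : {poly R[i]}) (s_ : 'I_l -> R[i]).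

Definition DB : {poly R[i]} := \prod_(j < l) ('X - (s_ j)%:P).

(* For Re s <= 0 the expectation defining the transform of B need not converge,
   whence the rational function in place of LST B. *)
Definition PhiY (A : T -> R) (s : R[i]) : R[i] :=
  N.[s] / DB.[s] * LST A (- s).

(* Since x / 0 = 0, this expression is only meaningful where DB.[s] != 0; at the
   zeros of DB its singularity is removable.  U_W need not converge at s * y for
   y > 0; the integral over ]-oo, 0] carries the whole law of V when V < 0 a.s. *)
Definition Wstar_transform (V A : {RV P >-> R}) (UW : R[i] -> R[i]) (r : R)
    (a : 'I_l.+1 -> R[i]) (s : R[i]) : R[i] :=
  (1 - r%:C)^-1
  - (\sum_(k < l.+1) a k * s ^+ k) / (r%:C * DB.[s])
  + PhiY A s
    * cintegral (distribution P V) `]-oo, 0] (fun y => UW (s * y%:C)).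

Definition linear_system (V A : {RV P >-> R}) (w r : R)
    (a : 'I_l.+1 -> R[i]) : Prop :=
  forall j : 'I_l,
    \sum_(k < l.+1) a k * s_ j ^+ k *
      (1 - r%:C * N.[s_ j] * LST A (- s_ j) *
        cintegral (distribution P V) `]-oo, 0]
          (fun y => y%:C ^+ k / \prod_(m < l) (s_ j * y%:C - s_ m)))
    = r%:C * N.[s_ j] * LST A (- s_ j) *
        cintegral (distribution P V) `]-oo, 0]
          (fun y => cexp (- (s_ j * w%:C * y%:C))).

End Transforms.
End Model.

(* Main.v *)
Require Import Defs.
From HB Require Import structures.
From mathcomp Require Import all_boot all_order all_algebra.
From mathcomp Require Import cyclic separable cyclotomic complex.
From mathcomp Require Import all_classical all_reals all_analysis.
From mathcomp Require Import measurable_realfun ring lra.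

(** Write D for DB s_.  For a fixed x <= 0 the transform of max (x + B, 0) and
    that of the bounded variable min (x + B, 0) add up to 1 + e^{-sx} N(s)/D(s).
    Hence D times the former extends from Re s >= 0 to an entire function that is
    O(|s|^l), and by Liouville's theorem it is a polynomial of degree at most l,
    i.e. it coincides with its own Lagrange interpolation at 0, ..., l.  This last
    form is linear and survives integration over x = V_n W_n - A_n (which is
    nonpositive and independent of B_n) and summation against r^n.

    Uniqueness: the matrix of the linear system is square, so it suffices that its
    left kernel is trivial.  A left kernel vector is a linear functional on
    functions of s_j V.  The system is solvable for every starting point w >= 0,
    with the same a_0, so the functional takes the same value on all exponentials
    z |-> e^{-zw}.  Letting w tend to infinity this value is 0.  As 1/(z - s_m) is
    a bounded limit of combinations of such exponentials (Riemann sums of its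
    Laplace representation), the functional also kills 1 and all 1/(z - s_m), and
    testing it on z prod_(j <> m) (z - s_j) isolates the m-th entry of the
    vector. *)

Set Implicit Arguments.
Unset Strict Implicit.
Unset Printing Implicit Defensive.

Import Order.TTheory GRing.Theory Num.Theory.
Import numFieldNormedType.Exports.

Local Open Scope classical_set_scope.
Local Open Scope complex_scope.
Local Open Scope ring_scope.

(** * The complex norm and exponential *)

(** The two formulas live on opposite closed half-planes, and for Re s <= 0 the expectation of
    e^{-sB} may diverge. The link is one polynomial per step, [interp l (fun z => D.[z] * LST P (W
    n.+1) z)]: its nodes lie in Re s >= 0, where all expectations involved converge, yet it can be
    evaluated anywhere. For Re s <= 0 it equals D (1 - LST of Wstar n) plus a term containing LST of
    W n at s V, and V < 0 sends s V back to the right half-plane. All identities are kept multiplied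
    by D, so that they hold at s_j as well. There the term with U of Wstar vanishes and what remains
    is exactly the linear system. The quotient formula itself is recovered at s_j as a limit, from a
    Lipschitz estimate for U of Wstar. Summation is exchanged with integration over V by means of
    remainders of order r^n that are uniform in the argument of the transforms. *)

Notation normc := Normc.normc.

Section ComplexNorm.
Variable R : realType.
Implicit Types (x y z : R[i]) (a b t : R).

Lemma ReD x y : complex.Re (x + y) = complex.Re x + complex.Re y.
Proof. by case: x y => ? ? [? ?]. Qed.

Lemma ImD x y : complex.Im (x + y) = complex.Im x + complex.Im y.
Proof. by case: x y => ? ? [? ?]. Qed.

Lemma ReN x : complex.Re (- x) = - complex.Re x.
Proof. by case: x. Qed.

Lemma ImN x : complex.Im (- x) = - complex.Im x.
Proof. by case: x. Qed.

Lemma ReM x y : complex.Re (x * y) =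
  complex.Re x * complex.Re y - complex.Im x * complex.Im y.
Proof. by case: x y => ? ? [? ?]. Qed.

Lemma ImM x y : complex.Im (x * y) =
  complex.Re x * complex.Im y + complex.Im x * complex.Re y.
Proof. by case: x y => ? ? [? ?]. Qed.

Lemma ReMr x t : complex.Re (x * t%:C) = complex.Re x * t.
Proof. by rewrite ReM /= mulr0 subr0. Qed.

Lemma Re_sum (I : Type) (r : seq I) (Q : pred I) (F : I -> R[i]) :
  complex.Re (\sum_(i <- r | Q i) F i) = \sum_(i <- r | Q i) complex.Re (F i).
Proof. by apply: (big_morph (@complex.Re R)) => // x y; rewrite ReD. Qed.

Lemma Im_sum (I : Type) (r : seq I) (Q : pred I) (F : I -> R[i]) :
  complex.Im (\sum_(i <- r | Q i) F i) = \sum_(i <- r | Q i) complex.Im (F i).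
Proof. by apply: (big_morph (@complex.Im R)) => // x y; rewrite ImD. Qed.

Lemma eqC x y : complex.Re x = complex.Re y -> complex.Im x = complex.Im y -> x = y.
Proof. by case: x y => ? ? [? ?] /= -> ->. Qed.

Lemma normcE z : normc z = Num.sqrt (complex.Re z ^+ 2 + complex.Im z ^+ 2).
Proof. by case: z. Qed.

Lemma normrC z : `|z| = (normc z)%:C.
Proof. by rewrite normc_def normcE. Qed.

Lemma normc_ge0 z : 0 <= normc z.
Proof. by rewrite normcE sqrtr_ge0. Qed.

Lemma normc0 : normc (0 : R[i]) = 0. Proof. exact: Normc.normc0. Qed.
Lemma normc1 : normc (1 : R[i]) = 1. Proof. exact: Normc.normc1. Qed.
Lemma normcM x y : normc (x * y) = normc x * normc y.
Proof. exact: Normc.normcM. Qed.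
Lemma normcV x : normc x^-1 = (normc x)^-1.
Proof. exact: Normc.normcV. Qed.

Lemma normcN x : normc (- x) = normc x.
Proof. by rewrite !normcE ReN ImN !sqrrN. Qed.

Lemma normcR t : normc t%:C = `|t|.
Proof. by rewrite normcE /= expr0n addr0 sqrtr_sqr. Qed.

Lemma normc_eq0 z : (normc z == 0) = (z == 0).
Proof.
by apply/eqP/eqP => [/Normc.eq0_normc //|->]; rewrite normc0.
Qed.

Lemma normc_gt0 z : (0 < normc z) = (z != 0).
Proof. by rewrite lt0r normc_eq0 normc_ge0 andbT. Qed.

Lemma normcX z n : normc (z ^+ n) = normc z ^+ n.
Proof.
by elim: n => [|n IHn]; rewrite ?expr0 ?normc1// !exprS normcM IHn.
Qed.

Lemma normc_prod (I : Type) (r : seq I) (Q : pred I) (F : I -> R[i]) :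
  normc (\prod_(i <- r | Q i) F i) = \prod_(i <- r | Q i) normc (F i).
Proof. by apply: (big_morph _ normcM); exact: normc1. Qed.

Lemma ler_normcD x y : normc (x + y) <= normc x + normc y.
Proof. by rewrite -lecR rmorphD/= -!normrC ler_normD. Qed.

Lemma ler_normcB x y : normc (x - y) <= normc x + normc y.
Proof. by rewrite -(normcN y) ler_normcD. Qed.

Lemma normcBC x y : normc (x - y) = normc (y - x).
Proof. by rewrite -normcN opprB. Qed.

Lemma ler_normc_sum (I : Type) (r : seq I) (Q : pred I) (F : I -> R[i]) :
  normc (\sum_(i <- r | Q i) F i) <= \sum_(i <- r | Q i) normc (F i).
Proof.
elim/big_rec2: _ => [|i x z _ le_zx]; first by rewrite normc0.
by rewrite (le_trans (ler_normcD _ _))// lerD2l.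
Qed.

Lemma normc_ge_Re z : `|complex.Re z| <= normc z.
Proof. by rewrite normcE -sqrtr_sqr ler_wsqrtr// lerDl sqr_ge0. Qed.

Lemma normc_ge_Im z : `|complex.Im z| <= normc z.
Proof. by rewrite normcE -sqrtr_sqr ler_wsqrtr// lerDr sqr_ge0. Qed.

Lemma normc_sqr z : normc z ^+ 2 = complex.Re z ^+ 2 + complex.Im z ^+ 2.
Proof. by rewrite normcE sqr_sqrtr// addr_ge0// sqr_ge0. Qed.

Lemma normc_leD z : normc z <= `|complex.Re z| + `|complex.Im z|.
Proof.
rewrite -(ler_pXn2r (n := 2)) ?nnegrE ?normc_ge0 ?addr_ge0//.
rewrite normc_sqr sqrrD !real_normK ?num_real// lerD2r lerDl.
by rewrite mulrn_wge0// mulr_ge0.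
Qed.

End ComplexNorm.

(** * Estimates for the complex exponential and its Euler approximation *)

Section ComplexExp.
Variable R : realType.
Implicit Types (x y z : R[i]) (a b t : R).

Lemma normc_cexp z : normc (cexp z) = expR (complex.Re z).
Proof.
rewrite /cexp normcM normcR ger0_norm ?expR_ge0// normcE /=.
by rewrite cos2Dsin2 sqrtr1 mulr1.
Qed.

Lemma normc_cexp_le1 z : complex.Re z <= 0 -> normc (cexp z) <= 1.
Proof. by rewrite normc_cexp expR_le1. Qed.

Lemma cexpD x y : cexp (x + y) = cexp x * cexp y.
Proof.
rewrite /cexp ReD ImD expRD cosD sinD.
by apply: eqC; rewrite !(ReM, ImM) /=; ring.
Qed.

Lemma cexp0 : cexp (0 : R[i]) = 1.
Proof. by rewrite /cexp /= expR0 cos0 sin0 mul1r. Qed.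

Lemma cexpMn z n : cexp (z *+ n) = cexp z ^+ n.
Proof.
by elim: n => [|n IHn]; rewrite ?mulr0n ?cexp0// mulrS exprS cexpD IHn.
Qed.

Lemma normr_sin_le b : `|sin b| <= `|b|.
Proof.
wlog b0 : b / 0 <= b => [H|].
  have [|/ltW b0] := leP 0 b; first exact: H.
  by rewrite -(normrN b) -(normrN (sin b)) -sinN H// oppr_ge0.
have [c _ E] := @MVT_segment R sin cos 0 b b0 (fun u _ => is_derive_sin u)
  (continuous_subspaceT (@continuous_sin R)).
move: E; rewrite sin0 !subr0 => ->; rewrite normrM ler_piMl//.
exact: cos_max.
Qed.

Lemma cosB1 b : cos b - 1 = - (sin (b / 2) ^+ 2 *+ 2).
Proof.
have := cos_mulr2n (b / 2); have := cos2Dsin2 (b / 2).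
by rewrite -[b / 2 *+ 2]mulr_natr divfK ?pnatr_eq0// => E ->; lra.
Qed.

Lemma normr_cosB1 b : `|cos b - 1| <= b ^+ 2.
Proof.
rewrite cosB1 normrN normrMn normrX -(real_normK (num_real b)).
have := normr_sin_le (b / 2); rewrite normrM (ger0_norm (x := 2^-1))//.
have := normr_ge0 (sin (b / 2)); have := normr_ge0 b.
move: (Num.norm _) (Num.norm b) => u v v0 u0 uv.
by rewrite -mulr_natr; nra.
Qed.

(** The mean value theorem for sin u - u, whose derivative is cos u - 1, gains one power over
    [normr_cosB1]. *)
Lemma normr_sinB b : `|sin b - b| <= `|b| ^+ 3.
Proof.
wlog b0 : b / 0 <= b => [H|].
  have [|/ltW b0] := leP 0 b; first exact: H.
  by rewrite -(normrN b) -(normrN (_ - _)) opprD -sinN H// oppr_ge0.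
pose df (u : R) := cos u - 1.
have [c cb E] := @MVT_segment R (fun u => sin u - u) df 0 b b0
  (fun u _ => is_deriveB (is_derive_sin u) (is_derive_id u 1))
  (continuous_subspaceT (fun u => cvgB (@continuous_sin R u) cvg_id)).
move: E; rewrite sin0 !subr0 => ->; rewrite normrM exprSr ler_wpM2r//.
rewrite (le_trans (normr_cosB1 c))// -(real_normK (num_real c)).
move: cb; rewrite in_itv/= => /andP[c0 cb].
by rewrite ler_pXn2r ?nnegrE// !ger0_norm.
Qed.

Lemma normr_expRB1 a : `|expR a - 1| <= `|a| * expR `|a|.
Proof.
have [a0|a0] := leP 0 a.
  rewrite (ger0_norm a0) ger0_norm ?subr_ge0; last by rewrite (le_trans _ (expR_ge1Dx a))// lerDl.
  (* Multiplying 1 - a <= e^{-a} by e^a gives e^a - 1 <= a e^a. *)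
  have := expR_ge1Dx (- a); rewrite -(ler_pM2r (expR_gt0 a)) -expRD addNr expR0.
  by lra.
have := expR_ge1Dx a; have : expR a <= 1 by rewrite expR_le1 ltW.
have e1 : 1 <= expR (- a) by rewrite -expR0 ler_expR oppr_ge0 ltW.
move=> h1 h2; rewrite (ltr0_norm a0) distrC ger0_norm ?subr_ge0//.
by nra.
Qed.

(** From 1 - a <= e^{-a} one gets e^a <= 1/(1 - a), and 1/(1 - a) - 1 - a = a^2/(1 - a) <= 2 a^2
    since a <= 1/2. *)
Lemma normr_expRB1x a : `|a| <= 2^-1 -> `|expR a - 1 - a| <= 2 * a ^+ 2.
Proof.
rewrite ler_norml => /andP[a1 a2].
have h1 := expR_ge1Dx a; have h2 := expR_ge1Dx (- a).
have h3 : expR a * (1 - a) <= 1.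
  by rewrite -[leRHS](expRxMexpNx_1 a) ler_pM2l ?expR_gt0.
rewrite ger0_norm; last by lra.
by nra.
Qed.

(** The real part contributes |e^a - 1| |cos b| + |cos b - 1| and the imaginary part e^a |sin b|:
    three terms, each at most |z| e^{|z|}. *)
Lemma normc_cexpB1 z : normc (cexp z - 1) <= 3 * normc z * expR (normc z).
Proof.
apply: le_trans (normc_leD _) _; rewrite !ReD !ImD !ReN !ImN /cexp !ReM !ImM /=.
have ha := normc_ge_Re z; have hb := normc_ge_Im z.
move: (complex.Re z) (complex.Im z) (normc z) ha hb => a b n ha hb.
have e1 := normr_expRB1 a.
have s1 := normr_sin_le b; have c1 := cos_max b.
have c2 : `|cos b - 1| <= `|b|.
  rewrite cosB1 normrN normrMn normrX.
  have := normr_sin_le (b / 2); rewrite normrM (ger0_norm (x := 2^-1))//.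
  have := normr_ge0 (sin (b / 2)); have := sin_max (b / 2).
  move: (Num.norm (sin _)) (Num.norm b) => u v u1 u0 uv.
  by rewrite -mulr_natr; nra.
have n0 : 0 <= n by rewrite (le_trans _ ha).
have en : 1 <= expR n by rewrite -expR0 ler_expR.
have ean : expR `|a| <= expR n by rewrite ler_expR.
have ea : expR a <= expR n by rewrite ler_expR (le_trans (ler_norm _)).
have -> : expR a * cos b - 0 * sin b - 1 = (expR a - 1) * cos b + (cos b - 1).
  by ring.
have -> : expR a * sin b + 0 * cos b - 0 = expR a * sin b by ring.
have E1 : `|(expR a - 1) * cos b + (cos b - 1)| <= n * expR n + n * expR n.
  apply: le_trans (ler_normD _ _) _; apply: lerD.
    rewrite normrM -[leRHS]mulr1 ler_pM//.
    by rewrite (le_trans e1)// ler_pM// expR_ge0.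
  by rewrite (le_trans c2)// (le_trans hb)// ler_peMr.
have E2 : `|expR a * sin b| <= n * expR n.
  rewrite normrM [leLHS]mulrC ler_pM//; first by rewrite (le_trans s1).
  by rewrite ger0_norm ?expR_ge0.
lra.
Qed.

Lemma normc_cexpB1x z : normc z <= 2^-1 ->
  normc (cexp z - 1 - z) <= 4 * normc z ^+ 2.
Proof.
move=> z1; apply: le_trans (normc_leD _) _.
rewrite normc_sqr !ReD !ImD !ReN !ImN /cexp !ReM !ImM /=.
have ha := le_trans (normc_ge_Re z) z1; have hb := le_trans (normc_ge_Im z) z1.
move: (complex.Re z) (complex.Im z) ha hb => a b ha hb {z1}.
have e1 := normr_expRB1x ha.
have c2 := normr_cosB1 b; have s1 := normr_sin_le b.
have s3 := normr_sinB b; have c1 := cos_max b.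
have -> : expR a * cos b - 0 * sin b - 1 - a =
  (expR a - 1 - a) * cos b + (1 + a) * (cos b - 1) by ring.
have -> : expR a * sin b + 0 * cos b - 0 - b =
  (expR a - 1 - a) * sin b + a * sin b + (sin b - b) by ring.
have a2 : `|1 + a| <= 3 / 2.
  by rewrite (le_trans (ler_normD _ _))// normr1; lra.
have E1 : `|(expR a - 1 - a) * cos b + (1 + a) * (cos b - 1)| <=
    2 * a ^+ 2 * 1 + 3 / 2 * b ^+ 2.
  by rewrite (le_trans (ler_normD _ _))// !normrM lerD// ler_pM.
have E2 : `|(expR a - 1 - a) * sin b + a * sin b + (sin b - b)| <=
    2 * a ^+ 2 * 2^-1 + `|a| * `|b| + `|b| ^+ 3.
  rewrite (le_trans (ler_normD _ _))// lerD// (le_trans (ler_normD _ _))//.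
  by rewrite !normrM lerD// ler_pM// (le_trans s1).
have b3 : `|b| ^+ 3 <= 2^-1 * b ^+ 2.
  by rewrite exprS real_normK ?num_real// ler_wpM2r// sqr_ge0.
have ab : `|a| * `|b| <= 2^-1 * a ^+ 2 + 2^-1 * b ^+ 2.
  rewrite -(real_normK (num_real a)) -(real_normK (num_real b)).
  by have := sqr_ge0 (`|a| - `|b|); move: (Num.norm a) (Num.norm b) => u v; nra.
have := sqr_ge0 a; have := sqr_ge0 b; lra.
Qed.

(** With h = z/n, e^z = (e^h)^n and the difference of n-th powers factors. The factor e^h - 1 - h is
    at most 4 |h|^2, as |h| <= 1/2, and the remaining sum of n products is at most n e^{|z|}. *)
Lemma cexp_approx z n : (0 < n)%N -> 2 * normc z <= n%:R ->
  normc (cexp z - (1 + z / n%:R) ^+ n) <=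
    4 * normc z ^+ 2 * expR (normc z) / n%:R.
Proof.
case: n => // n _ zn; set h := z / n.+1%:R.
have n0 : (0 : R) < n.+1%:R by [].
have nh : normc h = normc z / n.+1%:R.
  rewrite normcM normcV; congr (_ / _).
  by rewrite -[n.+1%:R](rmorph_nat (real_complex R)) normcR ger0_norm.
have h1 : normc h <= 2^-1.
  by rewrite nh ler_pdivrMr//; lra.
have -> : cexp z = cexp h ^+ n.+1.
  by rewrite -cexpMn -[h *+ _]mulr_natr divfK// pnatr_eq0.
have zE : normc z = normc h * n.+1%:R by rewrite nh divfK// gt_eqF.
rewrite subrXX normcM.
have B : normc (\sum_(i < n.+1) cexp h ^+ (n.+1.-1 - i) * (1 + h) ^+ i) <=
    n.+1%:R * expR (normc z).
  rewrite (le_trans (ler_normc_sum _ _ _))//.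
  rewrite (le_trans (y := \sum_(i < n.+1) expR (normc z)))//; last first.
    by rewrite sumr_const card_ord mulr_natl.
  apply: ler_sum => i _; rewrite normcM !normcX normc_cexp.
  have e1 : expR (complex.Re h) <= expR (normc h).
    by rewrite ler_expR (le_trans (ler_norm _))// normc_ge_Re.
  have e2 : normc (1 + h) <= expR (normc h).
    by rewrite (le_trans (ler_normcD _ _))// normc1 expR_ge1Dx.
  rewrite (le_trans (y := expR (normc h) ^+ (n - i) * expR (normc h) ^+ i))//.
    by rewrite ler_pM ?exprn_ge0 ?expR_ge0 ?normc_ge0// lerXn2r// nnegrE ?expR_ge0 ?normc_ge0.
  rewrite -exprD subnK -1?ltnS// -expRM_natl ler_expR zE mulrC.
  by rewrite ler_wpM2l ?normc_ge0// ler_nat.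
have A := normc_cexpB1x h1.
rewrite opprD addrA.
rewrite (le_trans (ler_pM _ _ A B)) ?normc_ge0//.
rewrite nh le_eqVlt; apply/orP; left; apply/eqP; field.
by rewrite gt_eqF.
Qed.

End ComplexExp.

(** * Liouville's theorem *)

Section Liouville.
Variable R : realType.
Implicit Types (p h : {poly R[i]}) (s z : R[i]).

(** In characteristic 0 the polynomial X^n - 1 is separable, so it has n distinct roots, and n
    distinct n-th roots of unity include a primitive one. *)
Lemma prim_root_exists n : (0 < n)%N -> {z : R[i] | n.-primitive_root z}.
Proof.
move=> n0; have [r Dp] := closed_field_poly_normal ('X^n - 1 : {poly R[i]}).
apply/sigW; rewrite (monicP _) ?monicXnsubC// scale1r in Dp.
have rn1 : all n.-unity_root r by apply/allP => z; rewrite -root_prod_XsubC -Dp.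
have sz_r : (n < (size r).+1)%N.
  by rewrite -(size_prod_XsubC r id) -Dp size_XnsubC.
have [|z] := hasP (has_prim_root n0 rn1 _ sz_r); last by exists z.
by rewrite -separable_prod_XsubC -Dp separable_Xn_sub_1// pnatr_eq0 -lt0n.
Qed.

(** Orthogonality of characters: for i <> k the sum is geometric, with a ratio different from 1
    whose m-th power is 1. *)
Lemma sum_prim_root m (w : R[i]) i k : m.-primitive_root w ->
  (i < m)%N -> (k < m)%N ->
  \sum_(j < m) (w ^+ i / w ^+ k) ^+ j = (i == k)%:R *+ m.
Proof.
move=> wm im km; have m0 := prim_order_gt0 wm.
have w0 : w != 0.
  apply/eqP => w0; have /eqP := prim_expr_order wm.
  by rewrite w0 expr0n gtn_eqF// eq_sym oner_eq0.
have [->|ik] := eqVneq i k.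
  under eq_bigr do rewrite divff ?expf_neq0// expr1n.
  by rewrite sumr_const card_ord.
rewrite mul0rn; set z := _ / _.
have z1 : z - 1 != 0.
  rewrite subr_eq0 -(inj_eq (mulIf (expf_neq0 k w0))) mul1r divfK ?expf_neq0//.
  by rewrite (eq_prim_root_expr wm) !modn_small.
apply: (mulfI z1); rewrite mulr0 -subrX1 /z expr_div_n -!exprM.
rewrite ![(_ * m)%N]mulnC !exprM (prim_expr_order wm) !expr1n divr1 subrr//.
Qed.

(** An average over the m-th roots of unity plays the part of Cauchy's integral. It is exact because
    m exceeds k and the index of every nonzero coefficient, so that distinct indices stay distinct
    modulo m. *)
Lemma cauchy_estimate h (rho M : R) : 0 < rho ->
  (forall z, normc z = rho -> normc h.[z] <= M) ->
  forall k, normc h`_k * rho ^+ k <= M.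
Proof.
move=> rho0 hM k; pose m := (maxn (size h) k.+1).
have m0 : (0 < m)%N by rewrite (leq_trans _ (leq_maxr _ _)).
have [w wm] := prim_root_exists m0.
have w1 : normc w = 1.
  have := congr1 (@Normc.normc R) (prim_expr_order wm).
  rewrite normcX normc1 => /eqP; rewrite pexpr_eq1 ?normc_ge0// => /eqP.
  by [].
have w0 : w != 0 by rewrite -normc_gt0 w1.
have zE j : normc (rho%:C * w ^+ j) = rho.
  by rewrite normcM normcX w1 expr1n mulr1 normcR gtr0_norm.
have E : h`_k * rho%:C ^+ k *+ m =
    \sum_(j < m) h.[rho%:C * w ^+ j] / w ^+ k ^+ j.
  transitivity (\sum_(j < m) \sum_(i < m)
      h`_i * rho%:C ^+ i * (w ^+ i / w ^+ k) ^+ j).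
    rewrite exchange_big/= (bigD1 (Ordinal (leq_maxr (size h) k.+1)))//=.
    rewrite -mulr_sumr sum_prim_root ?leq_maxr// eqxx big1 => [|i ik].
      by rewrite addr0 mulrnAr mulr1.
    rewrite -mulr_sumr sum_prim_root ?leq_maxr//.
    by rewrite -val_eqE/= in ik; rewrite (negbTE ik) mul0rn mulr0.
  apply: eq_bigr => j _.
  rewrite (horner_coef_wide _ (leq_maxl _ k.+1)) mulr_suml; apply: eq_bigr => i _.
  by rewrite !exprMn exprVn -!exprM [(i * j)%N]mulnC; ring.
have : normc (h`_k * rho%:C ^+ k *+ m) <= M *+ m.
  rewrite E (le_trans (ler_normc_sum _ _ _))//.
  apply: (le_trans (y := \sum_(j < m) M)); last by rewrite sumr_const card_ord.
  apply: ler_sum => j _; rewrite normcM normcV !normcX w1 !expr1n invr1 mulr1.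
  exact: hM.
rewrite -mulr_natr -(rmorph_nat (real_complex R)) !normcM normcX !normcR.
rewrite (gtr0_norm rho0) normr_nat -[leRHS]mulr_natr ler_pM2r ?ltr0n//.
Qed.

(** The Cauchy estimates dominate the terms of h by a geometric series of ratio 1/2 when |s| <=
    rho/2; its sum is the factor 2, where the maximum principle proper has 1. *)
Lemma poly_max_principle h (rho M : R) s : 0 < rho ->
  (forall z, normc z = rho -> normc h.[z] <= M) ->
  normc s <= rho / 2 -> normc h.[s] <= 2 * M.
Proof.
move=> rho0 hM sr; have M0 : 0 <= M.
  by rewrite (le_trans _ (hM rho%:C _)) ?normc_ge0// normcR gtr0_norm.
rewrite horner_coef (le_trans (ler_normc_sum _ _ _))//.
have T k : normc (h`_k * s ^+ k) <= M * 2^-1 ^+ k.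
  rewrite normcM normcX.
  have := cauchy_estimate rho0 hM k; rewrite -ler_pdivlMr ?exprn_gt0// => ck.
  rewrite (le_trans (ler_pM _ _ ck (lerXn2r k _ _ sr)))//.
  - by rewrite normc_ge0.
  - by rewrite exprn_ge0// normc_ge0.
  - by rewrite nnegrE normc_ge0.
  - by rewrite nnegrE divr_ge0// ltW.
  - by rewrite exprMn mulrA divfK// expf_neq0// gt_eqF.
rewrite (le_trans (ler_sum _ (fun i _ => T (nat_of_ord i))))// -mulr_sumr mulrC.
rewrite ler_wpM2r//.
elim: (size h) => [|n IHn]; first by rewrite big_ord0.
rewrite big_ord_recl expr0; under eq_bigr do rewrite /bump/= exprS.
rewrite -mulr_sumr; lra.
Qed.

Definition lag n (i : 'I_n.+1) : {poly R[i]} :=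
  tnth (lagrange n.+1 (fun j : nat => j%:R : R[i])) i.

(** The nodes are natural numbers because these lie in Re z >= 0, where the transforms converge and
    [DB] has no zero. *)
Definition interp n (f : R[i] -> R[i]) : {poly R[i]} :=
  \sum_(i < n.+1) f i%:R *: lag i.

Let natC_inj : injective (fun j : nat => j%:R : R[i]).
Proof. by move=> i j /eqP; rewrite eqr_nat => /eqP. Qed.

Lemma size_lag n (i : 'I_n.+1) : (size (lag i) <= n.+1)%N.
Proof. exact: size_npoly. Qed.

Lemma size_interp n f : (size (interp n f) <= n.+1)%N.
Proof.
rewrite (leq_trans (size_sum _ _ _))//; apply/bigmax_leqP => i _.
by rewrite (leq_trans (size_scale_leq _ _))// size_lag.
Qed.

Lemma lag_sample n (i j : 'I_n.+1) : (lag i).[j%:R] = (i == j)%:R.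
Proof. exact: (lagrange_sample (n := n.+1) isT natC_inj). Qed.

Lemma horner_interp n f (i : 'I_n.+1) : (interp n f).[i%:R] = f i%:R.
Proof.
rewrite horner_sum (bigD1 i)//= big1 => [|j ji].
  by rewrite addr0 hornerZ lag_sample eqxx mulr1.
by rewrite hornerZ lag_sample (negbTE ji) mulr0.
Qed.

Definition l1norm p : R := \sum_(k < size p) normc p`_k.

Lemma l1norm_ge0 p : 0 <= l1norm p.
Proof. by apply: sumr_ge0 => k _; exact: normc_ge0. Qed.

Lemma normc_horner n p z : (size p <= n.+1)%N ->
  normc p.[z] <= l1norm p * (1 + normc z) ^+ n.
Proof.
move=> sp; rewrite horner_coef (le_trans (ler_normc_sum _ _ _))// mulr_suml.
apply: ler_sum => k _; rewrite normcM normcX ler_wpM2l ?normc_ge0//.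
have z1 : 1 <= 1 + normc z by rewrite lerDl normc_ge0.
rewrite (le_trans (y := (1 + normc z) ^+ k))//.
  by rewrite lerXn2r ?nnegrE ?addr_ge0 ?normc_ge0// lerDr.
by rewrite ler_weXn2l// -ltnS (leq_trans (ltn_ord k)).
Qed.

(* Uniform polynomial approximation on every disc is the form of holomorphy used here. *)
Definition entire (f : R[i] -> R[i]) := forall rho e : R, 0 < e ->
  exists p, forall s, normc s <= rho -> normc (f s - p.[s]) <= e.

Lemma normc_nat n : normc (n%:R : R[i]) = n%:R.
Proof. by rewrite -(rmorph_nat (real_complex R)) normcR normr_nat. Qed.

(** On the disc of radius rho, f is replaced by a polynomial p with error 1/rho. Then q = p - interp
    n p vanishes at the nodes, hence is divisible by om, whose degree n + 1 beats the growth of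
    order n. The quotient is O(1/rho) on the circle and, by [poly_max_principle], at s; let rho tend
    to infinity. *)
Lemma liouville n (f : R[i] -> R[i]) (K : R) : entire f ->
  (forall s, normc (f s) <= K * (1 + normc s) ^+ n) ->
  forall s, f s = (interp n f).[s].
Proof.
move=> fe fK s; apply/eqP; rewrite -subr_eq0 -normc_eq0.
have K0 : 0 <= K.
  have := fK 0; rewrite normc0 addr0 expr1n mulr1.
  exact: le_trans (normc_ge0 _).
pose F : R := K * (1 + n%:R) ^+ n.
have fF (i : 'I_n.+1) : normc (f i%:R) <= F.
  rewrite (le_trans (fK _))// ler_wpM2l// lerXn2r ?nnegrE ?addr_ge0 ?normc_ge0//.
  by rewrite normc_nat lerD2l ler_nat -ltnS.
pose CL : R := \sum_(i < n.+1) l1norm (lag i).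
(* On |z| = rho, |q| <= C1 (1 + rho)^n; the summands 1 pay for replacing f by p, since 1/rho <=
   1. *)
pose C1 : R := (K + 1) + (F + 1) * CL.
pose om : {poly R[i]} := \prod_(i < n.+1) ('X - (i%:R)%:P).
(* From 1 + rho <= 2 rho and |om| >= (rho/2)^(n+1): (2 rho)^n / (rho/2)^(n+1) = 2^n 2^(n+1) /
   rho. *)
pose C2 : R := C1 * (2 ^+ n * 2 ^+ n.+1).
pose S : R := \sum_(i < n.+1) normc (lag i).[s].
pose C3 : R := 1 + 2 * C2 * normc om.[s] + S.
(* Keeps s and all nodes within rho/2 for every rho >= rho0. *)
pose rho0 : R := 2 + 2 * n%:R + 2 * normc s.
have ns := normc_ge0 s; have nn : (0 : R) <= n%:R by [].
suff B rho : rho0 <= rho -> normc (f s - (interp n f).[s]) * rho <= C3.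
  have x0 := normc_ge0 (f s - (interp n f).[s]).
  rewrite eq_le x0 andbT leNgt; apply/negP => x1.
  (* For this rho the left side of the bound exceeds C3: the second summand alone contributes C3 +
     1. *)
  have := B (rho0 + (C3 + 1) / normc (f s - (interp n f).[s])).
  rewrite mulrDr mulrCA divff ?gt_eqF// mulr1.
  have rho0_ge0 : 0 <= rho0 by rewrite /rho0; lra.
  have C30 : 0 <= C3 by rewrite (le_trans _ (B rho0 (lexx _)))// mulr_ge0.
  have q0 : 0 <= (C3 + 1) / normc (f s - (interp n f).[s]).
    by rewrite divr_ge0//; lra.
  have q1 : 0 <= normc (f s - (interp n f).[s]) * rho0.
    by rewrite mulr_ge0// /rho0; lra.
  have le_rho0 : rho0 <= rho0 + (C3 + 1) / normc (f s - (interp n f).[s]).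
    by rewrite lerDl.
  by move=> /(_ le_rho0); lra.
move=> hrho.
have rho_gt0 : 0 < rho by rewrite (lt_le_trans _ hrho)// /rho0; lra.
have rho1 : rho^-1 <= 1.
  by rewrite invf_le1// (le_trans _ hrho)// /rho0; lra.
have rhoi : 0 < rho^-1 by rewrite invr_gt0.
have [p pf] := fe rho rho^-1 rhoi.
pose q := p - interp n (horner p).
have q_dvd : om %| q.
  rewrite /om -(big_map (fun i : 'I_n.+1 => (i%:R : R[i])) xpredT (fun c => 'X - c%:P)).
  apply: uniq_roots_dvdp.
    apply/allP => _ /mapP[i _ ->]; rewrite rootE /q hornerD hornerN.
    by rewrite horner_interp subrr.
  rewrite uniq_rootsE map_inj_uniq ?index_enum_uniq// => i j /natC_inj ij.
  exact: val_inj.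
have node i : (i < n.+1)%N -> normc (i%:R : R[i]) <= rho.
  rewrite ltnS normc_nat => ni; rewrite (le_trans _ hrho)//.
  by move: ni; rewrite -(ler_nat R) /rho0; lra.
have pF (i : 'I_n.+1) : normc p.[i%:R] <= F + 1.
  rewrite -[p.[_]](subKr (f i%:R)) (le_trans (ler_normcB _ _))// lerD//.
  by rewrite (le_trans (pf _ (node _ (ltn_ord i)))).
have CL0 : 0 <= CL by apply: sumr_ge0 => i _; exact: l1norm_ge0.
have F0 : 0 <= F by rewrite mulr_ge0// exprn_ge0// addr_ge0.
have hq z : normc z = rho -> normc q.[z] <= C1 * (1 + rho) ^+ n.
  move=> zr; have r1 : 1 <= (1 + rho) ^+ n by rewrite exprn_ege1// lerDl ltW.
  rewrite /q hornerD hornerN (le_trans (ler_normcB _ _))// /C1 [leRHS]mulrDl.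
  apply: lerD.
    rewrite -[p.[_]](subKr (f z)) (le_trans (ler_normcB _ _))// mulrDl mul1r.
    rewrite lerD//; first by rewrite -zr fK.
    by rewrite (le_trans (pf _ _)) ?zr// (le_trans rho1).
  rewrite horner_sum (le_trans (ler_normc_sum _ _ _))// /CL mulr_sumr mulr_suml.
  apply: ler_sum => i _; rewrite hornerZ normcM -mulrA.
  rewrite ler_pM ?normc_ge0// -zr normc_horner//.
  exact: size_lag.
have hom z : normc z = rho -> (rho / 2) ^+ n.+1 <= normc om.[z].
  move=> zr; rewrite /om horner_prod normc_prod.
  rewrite -[n.+1 in leLHS](card_ord n.+1) -prodr_const; apply: ler_prod => i _.
  rewrite divr_ge0 ?(ltW rho_gt0)//= hornerXsubC.
  have := ler_normcD (z - i%:R) i%:R; rewrite subrK zr normc_nat.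
  have : (i%:R : R) <= n%:R by rewrite ler_nat -ltnS.
  by move: hrho; rewrite /rho0; lra.
have C10 : 0 <= C1 by rewrite /C1 addr_ge0// ?mulr_ge0//; lra.
have hquo z : normc z = rho -> normc (q %/ om).[z] <= C2 / rho.
  move=> zr; have := hq z zr; rewrite -{1}(divpK q_dvd) hornerM normcM => h.
  have o0 : 0 < normc om.[z].
    by rewrite (lt_le_trans _ (hom z zr))// exprn_gt0// divr_gt0.
  rewrite -ler_pdivlMr// in h; rewrite (le_trans h)//.
  rewrite ler_pdivrMr// (le_trans (y := C2 / rho * (rho / 2) ^+ n.+1))//; last first.
    by rewrite ler_wpM2l ?hom// divr_ge0 ?(ltW rho_gt0)// mulr_ge0// mulr_ge0 ?exprn_ge0.
  rewrite /C2; have -> : C1 * (2 ^+ n * 2 ^+ n.+1) / rho * (rho / 2) ^+ n.+1 =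
      C1 * (2 * rho) ^+ n.
    rewrite exprMn exprVn [rho ^+ _]exprSr exprMn; field.
    by rewrite expf_neq0 ?pnatr_eq0//= gt_eqF.
  rewrite ler_wpM2l// lerXn2r ?nnegrE//; [lra|lra|].
  by move: hrho; rewrite /rho0; lra.
have qs : normc q.[s] <= 2 * C2 * normc om.[s] / rho.
  rewrite -(divpK q_dvd) hornerM normcM.
  have sr : normc s <= rho / 2 by move: hrho; rewrite /rho0; lra.
  have := poly_max_principle rho_gt0 hquo sr.
  move=> h; rewrite (le_trans (ler_wpM2r (normc_ge0 _) h))//.
  by rewrite le_eqVlt; apply/orP; left; apply/eqP; field; rewrite gt_eqF.
(* The three terms are at most 1/rho, 2 C2 |om(s)| / rho and S/rho, which add up to C3/rho. *)
have -> : f s - (interp n f).[s] = (f s - p.[s]) + q.[s] +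
    \sum_(i < n.+1) (p.[i%:R] - f i%:R) * (lag i).[s].
  rewrite /q hornerD hornerN !horner_sum.
  have -> : \sum_(i < n.+1) (p.[i%:R] - f i%:R) * (lag i).[s] =
     \sum_(i < n.+1) (p.[i%:R] *: lag i).[s] - \sum_(i < n.+1) (f i%:R *: lag i).[s].
    by rewrite -sumrB; apply: eq_bigr => i _; rewrite !hornerZ mulrBl.
  by ring.
rewrite -ler_pdivlMr//; apply: le_trans (ler_normcD _ _) _.
rewrite /C3 [leRHS]mulrDl [X in _ <= X + _]mulrDl; apply: lerD.
  rewrite (le_trans (ler_normcD _ _))// lerD//.
  by rewrite mul1r; apply: pf; move: hrho; rewrite /rho0; lra.
rewrite (le_trans (ler_normc_sum _ _ _))// /S mulr_suml; apply: ler_sum => i _.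
rewrite normcM mulrC ler_wpM2l ?normc_ge0// normcBC pf//.
exact: node.
Qed.

Lemma entire_poly p : entire (horner p).
Proof. by move=> rho e e0; exists p => s _; rewrite subrr normc0 ltW. Qed.

Lemma entireD f g : entire f -> entire g -> entire (fun s => f s + g s).
Proof.
move=> fe ge rho e e0; have e2 : 0 < e / 2 by rewrite divr_gt0.
have [[p pf] [q qg]] := (fe rho _ e2, ge rho _ e2); exists (p + q) => s sr.
rewrite hornerD (_ : _ - _ = (f s - p.[s]) + (g s - q.[s])); last by ring.
by rewrite (le_trans (ler_normcD _ _))// [leRHS]splitr lerD ?pf ?qg.
Qed.

Lemma entire_mull p f : entire f -> entire (fun s => p.[s] * f s).
Proof.
move=> fe rho e e0.
pose K := l1norm p * (1 + `|rho|) ^+ (size p).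
have K0 : 0 <= K by rewrite mulr_ge0 ?l1norm_ge0// exprn_ge0// addr_ge0.
have [|q qf] := fe rho (e / (K + 1)); first by rewrite divr_gt0//; lra.
exists (p * q) => s sr; rewrite hornerM -mulrBr normcM.
have pK : normc p.[s] <= K + 1.
  rewrite (le_trans (normc_horner s (leqnSn (size p))))//.
  rewrite (le_trans (y := K)) ?lerDl// ler_wpM2l ?l1norm_ge0//.
  rewrite lerXn2r ?nnegrE ?addr_ge0 ?normc_ge0// lerD2l.
  by rewrite (le_trans sr)// ler_norm.
rewrite (le_trans (ler_pM _ _ pK (qf s sr))) ?normc_ge0//.
by rewrite mulrC divfK// gt_eqF//; lra.
Qed.

End Liouville.

(** * Complex-valued integrals *)

Section ComplexMeasurable.
Context d (T : measurableType d) (R : realType).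
Implicit Types (f g : T -> R[i]) (h : T -> R).

(** Taken componentwise, to match [cintegral]. *)
Definition cmeasurable f :=
  measurable_fun setT (fun t => complex.Re (f t)) /\
  measurable_fun setT (fun t => complex.Im (f t)).

Lemma cmeasurable_cst c : cmeasurable (fun=> c).
Proof. by split; exact: measurable_cst. Qed.

Lemma cmeasurable_real h : measurable_fun setT h -> cmeasurable (fun t => (h t)%:C).
Proof. by move=> mh; split => //=; exact: measurable_cst. Qed.

Lemma cmeasurableD f g : cmeasurable f -> cmeasurable g ->
  cmeasurable (fun t => f t + g t).
Proof.
move=> [mf1 mf2] [mg1 mg2]; split.
- by under eq_fun do rewrite ReD; exact: measurable_funD.
- by under eq_fun do rewrite ImD; exact: measurable_funD.
Qed.

Lemma cmeasurableN f : cmeasurable f -> cmeasurable (fun t => - f t).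
Proof.
move=> [mf1 mf2]; split.
- by under eq_fun do rewrite ReN; exact: measurable_funN.
- by under eq_fun do rewrite ImN; exact: measurable_funN.
Qed.

Lemma cmeasurableM f g : cmeasurable f -> cmeasurable g ->
  cmeasurable (fun t => f t * g t).
Proof.
move=> [mf1 mf2] [mg1 mg2]; split.
- by under eq_fun do rewrite ReM; apply: measurable_funB; exact: measurable_funM.
- by under eq_fun do rewrite ImM; apply: measurable_funD; exact: measurable_funM.
Qed.

Lemma cmeasurableX f n : cmeasurable f -> cmeasurable (fun t => f t ^+ n).
Proof.
move=> mf; elim: n => [|n IHn]; first exact: cmeasurable_cst.
by under [X in cmeasurable X]eq_fun do rewrite exprS; exact: cmeasurableM.
Qed.

Lemma cmeasurable_sum (I : Type) (r : seq I) (F : I -> T -> R[i]) :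
  (forall i, cmeasurable (F i)) -> cmeasurable (fun t => \sum_(i <- r) F i t).
Proof.
move=> mF; elim: r => [|i r IHr].
  by under [X in cmeasurable X]eq_fun do rewrite big_nil; exact: cmeasurable_cst.
by under [X in cmeasurable X]eq_fun do rewrite big_cons; exact: cmeasurableD.
Qed.

(** The convention 0^-1 = 0 makes the inverse discontinuous at 0, so that point is split off. *)
Lemma measurable_invr : measurable_fun [set: R] (@GRing.inv R).
Proof.
have -> : [set: R] = [set r | r != 0] `|` [set 0].
  by apply/seteqP; split=> // r _ /=; have [->|] := eqVneq r 0; [right|left].
have m0 : measurable [set r : R | r != 0] by exact: open_measurable.
apply/measurable_funU => //; split.
  apply: open_continuous_measurable_fun => //; apply/in_setP => x /= x0.
  exact: inv_continuous.
exact: measurable_fun_set1.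
Qed.

Lemma cmeasurableV f : cmeasurable f -> cmeasurable (fun t => (f t)^-1).
Proof.
move=> [mf1 mf2].
have mV : measurable_fun setT
    (fun t => (complex.Re (f t) ^+ 2 + complex.Im (f t) ^+ 2)^-1).
  apply: (measurableT_comp measurable_invr).
  by apply: measurable_funD; exact: measurable_funX.
split.
  rewrite (_ : (fun t => _) = (fun t => complex.Re (f t) *
    (complex.Re (f t) ^+ 2 + complex.Im (f t) ^+ 2)^-1)).
    exact: measurable_funM.
  by apply/funext => t; case: (f t).
rewrite (_ : (fun t => _) = (fun t => - complex.Im (f t) *
    (complex.Re (f t) ^+ 2 + complex.Im (f t) ^+ 2)^-1)).
  by apply: measurable_funM => //; exact: measurable_funN.
by apply/funext => t; case: (f t) => a b /=; rewrite mulNr.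
Qed.

Lemma cmeasurable_cexp f : cmeasurable f -> cmeasurable (fun t => cexp (f t)).
Proof.
move=> [mf1 mf2].
have mc : measurable_fun setT (fun t => cos (complex.Im (f t))).
  exact: (measurableT_comp (continuous_measurable_fun (@continuous_cos R)) mf2).
have ms : measurable_fun setT (fun t => sin (complex.Im (f t))).
  exact: (measurableT_comp (continuous_measurable_fun (@continuous_sin R)) mf2).
have me : measurable_fun setT (fun t => expR (complex.Re (f t))).
  exact: (measurableT_comp (@measurable_expR R) mf1).
by rewrite /cexp; apply: (cmeasurableM (cmeasurable_real me)); split.
Qed.

Lemma cmeasurable_horner (p : {poly R[i]}) f : cmeasurable f ->
  cmeasurable (fun t => p.[f t]).
Proof.
move=> mf; under [X in cmeasurable X]eq_fun do rewrite horner_coef.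
apply: cmeasurable_sum => i; apply: cmeasurableM; first exact: cmeasurable_cst.
exact: cmeasurableX.
Qed.

End ComplexMeasurable.

Lemma cmeasurable_comp d d' (T : measurableType d) (T' : measurableType d')
    (R : realType) (f : T' -> R[i]) (X : T -> T') :
  cmeasurable f -> measurable_fun setT X -> cmeasurable (fun t => f (X t)).
Proof.
move=> [mf1 mf2] mX; split; [exact: (measurableT_comp mf1 mX)|].
exact: (measurableT_comp mf2 mX).
Qed.

(** * Bounds, linearity and dominated convergence under a probability *)

Section ComplexIntegral.
Context d (T : measurableType d) (R : realType) (P : probability T R).
Implicit Types (f g : T -> R[i]).

Definition cintegrable f :=
  P.-integrable setT (EFin \o (fun t => complex.Re (f t))) /\
  P.-integrable setT (EFin \o (fun t => complex.Im (f t))).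

Local Notation E := (cintegral P setT).

Lemma cintegrable_measurable f : cintegrable f -> cmeasurable f.
Proof.
by move=> [i1 i2]; split; apply/measurable_EFinP; [exact: measurable_int i1|
  exact: measurable_int i2].
Qed.

Lemma integrable_ae_bounded (h : T -> R) (C : R) : measurable_fun setT h ->
  {ae P, forall t, `|h t| <= C} ->
  P.-integrable setT (EFin \o h) /\ `|\int[P]_(t in setT) h t| <= C.
Proof.
move=> mh hC.
(* The exceptional set cannot be the whole space, which has mass 1; a point outside it shows 0 <=
   C. *)
have [t0 Ct0] : exists t, `|h t| <= C.
  apply: contrapT => /forallNP nC.
  move: hC => [N [mN PN subN]].
  have NT : N = setT by apply/seteqP; split => // t _; apply: subN; exact: nC.
  by move: PN; rewrite NT probability_setT => /eqP; rewrite eqe oner_eq0.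
have C0 : 0 <= C := le_trans (normr_ge0 _) Ct0.
have B : (\int[P]_(t in setT) `|(h t)%:E| <= C%:E)%E.
  apply: (le_trans (@integral_le_bound _ _ _ P setT (EFin \o h) C%:E
    measurableT _ _ _)).
  - exact/measurable_EFinP.
  - by rewrite lee_fin.
  - by apply: filterS hC => t /= hC _; rewrite lee_fin.
  - rewrite -[leRHS]mule1 -(probability_setT P)//.
have ih : P.-integrable setT (EFin \o h).
  apply/integrableP; split; first exact/measurable_EFinP.
  by rewrite (le_lt_trans B)// ltry.
split=> //; apply: le_trans (le_normr_Rintegral measurableT ih) _.
rewrite -lee_fin /Rintegral fineK//.
by apply: integrable_fin_num => //; exact: integrable_abse ih.
Qed.

(** The two components are bounded separately by C, whence the factor 2, which reappears in the
    later constants. *)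
Lemma cintegrable_bounded f C : cmeasurable f ->
  {ae P, forall t, normc (f t) <= C} -> cintegrable f /\ normc (E f) <= 2 * C.
Proof.
move=> [mf1 mf2] fC.
have [||i1 b1] := @integrable_ae_bounded (fun t => complex.Re (f t)) C => //.
  by apply: filterS fC => t; apply: le_trans; exact: normc_ge_Re.
have [||i2 b2] := @integrable_ae_bounded (fun t => complex.Im (f t)) C => //.
  by apply: filterS fC => t; apply: le_trans; exact: normc_ge_Im.
split=> //; rewrite (le_trans (normc_leD _))//=; lra.
Qed.

Lemma bounded_cintegrable f C : cmeasurable f ->
  {ae P, forall t, normc (f t) <= C} -> cintegrable f.
Proof. by move=> mf /(cintegrable_bounded mf)[]. Qed.

Lemma cintegral_bound f C : cmeasurable f ->
  {ae P, forall t, normc (f t) <= C} -> normc (E f) <= 2 * C.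
Proof. by move=> mf /(cintegrable_bounded mf)[]. Qed.

Lemma cintegrable_cst c : cintegrable (fun=> c).
Proof.
apply: (@bounded_cintegrable _ (normc c)); first exact: cmeasurable_cst.
exact: aeW.
Qed.

Lemma cintegrableD f g : cintegrable f -> cintegrable g ->
  cintegrable (fun t => f t + g t).
Proof.
move=> [f1 f2] [g1 g2]; split.
- rewrite (_ : EFin \o _ = (EFin \o (fun t => complex.Re (f t))) \+
    (EFin \o (fun t => complex.Re (g t))))%E; first exact: integrableD.
  by apply/funext => t /=; rewrite ReD.
- rewrite (_ : EFin \o _ = (EFin \o (fun t => complex.Im (f t))) \+
    (EFin \o (fun t => complex.Im (g t))))%E; first exact: integrableD.
  by apply/funext => t /=; rewrite ImD.
Qed.

Lemma cintegrableZl c f : cintegrable f -> cintegrable (fun t => c * f t).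
Proof.
move=> [f1 f2]; split.
- rewrite (_ : EFin \o _ =
    (fun t => (complex.Re c)%:E * (complex.Re (f t))%:E) \-
    (fun t => (complex.Im c)%:E * (complex.Im (f t))%:E))%E.
    by apply: integrableB => //; exact: integrableZl.
  by apply/funext => t /=; rewrite ReM.
- rewrite (_ : EFin \o _ =
    (fun t => (complex.Re c)%:E * (complex.Im (f t))%:E) \+
    (fun t => (complex.Im c)%:E * (complex.Re (f t))%:E))%E.
    by apply: integrableD => //; exact: integrableZl.
  by apply/funext => t /=; rewrite ImM.
Qed.

Lemma cintegrable_sum (I : Type) (r : seq I) (F : I -> T -> R[i]) :
  (forall i, cintegrable (F i)) -> cintegrable (fun t => \sum_(i <- r) F i t).
Proof.
move=> iF; elim: r => [|i r IHr].
  by under [X in cintegrable X]eq_fun do rewrite big_nil; exact: cintegrable_cst.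
by under [X in cintegrable X]eq_fun do rewrite big_cons; exact: cintegrableD.
Qed.

Lemma eq_cintegral f g : f =1 g -> E f = E g.
Proof. by move=> /funext ->. Qed.

Lemma cintegral_cst c : E (fun=> c) = c.
Proof.
have P1 : (P : {measure set T -> \bar R}) setT = 1%E by exact: probability_setT.
by rewrite /cintegral !Rintegral_cst// !P1/= !mulr1; case: c.
Qed.

Lemma cintegralD f g : cintegrable f -> cintegrable g ->
  E (fun t => f t + g t) = E f + E g.
Proof.
move=> [f1 f2] [g1 g2]; apply: eqC => /=.
- by under eq_Rintegral do rewrite ReD; rewrite RintegralD.
- by under eq_Rintegral do rewrite ImD; rewrite RintegralD.
Qed.

Lemma cintegralZl c f : cintegrable f -> E (fun t => c * f t) = c * E f.
Proof.
move=> [f1 f2].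
have iZ k h : P.-integrable setT (EFin \o h) ->
    P.-integrable setT (EFin \o (fun t => k * h t)).
  move=> ih; rewrite (_ : EFin \o _ = (fun t => k%:E * (h t)%:E)%E)//.
  exact: integrableZl.
apply: eqC; rewrite (ReM, ImM) /=.
- under eq_Rintegral do rewrite ReM; rewrite RintegralB//; try exact: iZ.
  by rewrite !RintegralZl.
- under eq_Rintegral do rewrite ImM; rewrite RintegralD//; try exact: iZ.
  by rewrite !RintegralZl.
Qed.

Lemma cintegral_sum (I : Type) (r : seq I) (F : I -> T -> R[i]) :
  (forall i, cintegrable (F i)) ->
  E (fun t => \sum_(i <- r) F i t) = \sum_(i <- r) E (F i).
Proof.
move=> iF; elim: r => [|i r IHr].
  rewrite big_nil -[RHS]cintegral_cst; apply: eq_cintegral => t.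
  by rewrite big_nil.
rewrite big_cons -IHr -cintegralD//; last exact: cintegrable_sum.
by apply: eq_cintegral => t; rewrite big_cons.
Qed.

Lemma ae_eq_cintegral f g : cmeasurable f -> cmeasurable g ->
  {ae P, forall t, f t = g t} -> E f = E g.
Proof.
move=> [f1 f2] [g1 g2] fg; apply: eqC => /=; congr fine;
  apply: ae_eq_integral => //; try exact/measurable_EFinP.
- by apply: filterS fg => t /= -> .
- by apply: filterS fg => t /= -> .
Qed.

Lemma cvg_cintegral (f_ : nat -> T -> R[i]) f C :
  (forall n, cmeasurable (f_ n)) -> cmeasurable f ->
  {ae P, forall t, forall n, normc (f_ n t) <= C} ->
  {ae P, forall t, normc (f_ n t - f t) @[n --> \oo] --> (0 : R)} ->
  normc (E (f_ n) - E f) @[n --> \oo] --> (0 : R).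
Proof.
move=> mf_ mf fC fcvg.
have key (h_ : nat -> T -> R) (h : T -> R) :
    (forall n, measurable_fun setT (h_ n)) -> measurable_fun setT h ->
    (forall n t, `|h_ n t| <= normc (f_ n t)) ->
    (forall n t, `|h_ n t - h t| <= normc (f_ n t - f t)) ->
    (\int[P]_(t in setT) h_ n t)%R @[n --> \oo] --> (\int[P]_(t in setT) h t)%R.
  move=> mh_ mh hf_ hf.
  have [] := @dominated_convergence _ _ _ P setT measurableT
    (fun n => EFin \o h_ n) (EFin \o h) (cst C%:E).
  - by move=> n; exact/measurable_EFinP.
  - exact/measurable_EFinP.
  - apply: filterS fcvg => t ft _; apply: cvg_EFin; first exact: nearW.
    have H : `|h_ n t - h t| @[n --> \oo] --> (0 : R).
      apply: (squeeze_cvgr _ (cvg_cst 0) ft).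
      by apply: nearW => n /=; rewrite normr_ge0 hf.
    by apply/subr_cvg0; exact: norm_cvg0 H.
  - exact: finite_measure_integrable_cst.
  - apply: filterS fC => t fCt n _ /=; rewrite lee_fin.
    by rewrite (le_trans (hf_ _ _)).
  move=> ih _ h_h; apply: fine_cvg; rewrite /Rintegral fineK; first exact: h_h.
  exact: integrable_fin_num.
have c1 := key (fun n t => complex.Re (f_ n t)) (fun t => complex.Re (f t))
  (fun n => (mf_ n).1) mf.1 (fun n t => normc_ge_Re _)
  (fun n t => ltac:(by rewrite -ReN -ReD normc_ge_Re)).
have c2 := key (fun n t => complex.Im (f_ n t)) (fun t => complex.Im (f t))
  (fun n => (mf_ n).2) mf.2 (fun n t => normc_ge_Im _)
  (fun n t => ltac:(by rewrite -ImN -ImD normc_ge_Im)).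
have c3 : (`|complex.Re (E (f_ n) - E f)| + `|complex.Im (E (f_ n) - E f)|)
    @[n --> \oo] --> (0 : R).
  rewrite -[0](addr0 0); apply: cvgD.
  - rewrite -(@normr0 _ R) -(subrr (complex.Re (E f))).
    by under eq_fun do rewrite ReD ReN; apply: cvg_norm; apply: cvgB => //; exact: cvg_cst.
  - rewrite -(@normr0 _ R) -(subrr (complex.Im (E f))).
    by under eq_fun do rewrite ImD ImN; apply: cvg_norm; apply: cvgB => //; exact: cvg_cst.
apply: (squeeze_cvgr _ (cvg_cst 0) c3).
by apply: nearW => n; rewrite normc_ge0 normc_leD.
Qed.

End ComplexIntegral.

(** * Independence *)

Section IndependentPair.
Context d (T : measurableType d) (R : realType) (P : probability T R).
Implicit Types (X Y : T -> R).

Definition independent X Y := forall E F : set R, measurable E -> measurable F ->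
  P (X @^-1` E `&` Y @^-1` F) = (P (X @^-1` E) * P (Y @^-1` F))%E.

(** Rectangles are stable under intersection and generate the product sigma-algebra. *)
Let pair_law_unique (m1 m2 : {measure set (R * R) -> \bar R}) :
  (m1 setT < +oo)%E ->
  (forall E F : set R, measurable E -> measurable F -> m1 (E `*` F) = m2 (E `*` F)) ->
  forall S, measurable S -> m1 S = m2 S.
Proof.
move=> m1T m12 S mS.
pose C : set (set (R * R)) :=
  [set C | exists2 E, measurable E & exists2 F, measurable F & E `*` F = C].
apply: (measure_unique C (fun=> setT)) => //.
- by rewrite measurable_prod_measurableType.
- move=> _ _ [E1 mE1 [F1 mF1 <-]] [E2 mE2 [F2 mF2 <-]].
  rewrite -setXI; exists (E1 `&` E2); first exact: measurableI.
  by exists (F1 `&` F2) => //; exact: measurableI.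
- by move=> _; exists setT => //; exists setT => //; rewrite setXTT.
- by rewrite bigcup_const.
- by move=> _ [E mE [F mF <-]]; exact: m12.
Qed.

(** Independence says that (X, Y) under P and (X z.1, Y z.2) under the product of P with itself have
    the same law on the plane; Fubini for the product then yields the iterated integral. *)
Lemma integral_independent X Y (h : R * R -> R) :
  measurable_fun setT X -> measurable_fun setT Y -> independent X Y ->
  measurable_fun setT h ->
  P.-integrable setT (EFin \o (fun t => h (X t, Y t))) ->
  P.-integrable setT (EFin \o (fun t => \int[P]_(t' in setT) h (X t, Y t'))%R) /\
  (\int[P]_(t in setT) h (X t, Y t) =
   \int[P]_(t in setT) (\int[P]_(t' in setT) h (X t, Y t')))%R.
Proof.
move=> mX mY iXY mh ih.
have mphi : measurable_fun setT (fun t => (X t, Y t)) by exact: measurable_fun_pair.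
have mpsi : measurable_fun setT (fun z : T * T => (X z.1, Y z.2)).
  by apply: measurable_fun_pair; apply: measurableT_comp.
pose phi : {mfun T >-> (R * R)%type} :=
  HB.pack (fun t => (X t, Y t)) (isMeasurableFun.Build _ _ _ _ _ mphi).
pose psi : {mfun (T * T)%type >-> (R * R)%type} :=
  HB.pack (fun z : T * T => (X z.1, Y z.2)) (isMeasurableFun.Build _ _ _ _ _ mpsi).
have m12 : forall S, measurable S ->
    pushforward P phi S = pushforward (P \x P)%E psi S.
  apply: (@pair_law_unique (pushforward P phi) (pushforward (P \x P)%E psi)).
    change (P (phi @^-1` setT) < +oo)%E.
    by rewrite preimage_setT probability_setT ltry.
  move=> E F mE mF.
  change (P (X @^-1` E `&` Y @^-1` F) =
    (P \x P)%E ((X @^-1` E) `*` (Y @^-1` F))).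
  rewrite product_measure1E.
  - exact: iXY.
  - by rewrite -[X in measurable X]setTI; exact: mX.
  - by rewrite -[X in measurable X]setTI; exact: mY.
have mEh : measurable_fun setT (EFin \o h) by exact/measurable_EFinP.
have eqm f : (\int[pushforward P phi]_x f x = \int[pushforward (P \x P) psi]_x f x)%E.
  by apply: eq_measure_integral => S mS _; exact: m12.
have ipsi : (P \x P)%E.-integrable setT (EFin \o h \o psi).
  apply/integrableP; split; first exact: measurableT_comp.
  have := ge0_integral_pushforward mpsi (P \x P)%E measurableT
    (measurableT_comp (@abse_measurable R setT) mEh) (fun y _ => abse_ge0 _).
  rewrite preimage_setT => <-; rewrite -[ltLHS]eqm.
  have := ge0_integral_pushforward mphi P measurableT
    (measurableT_comp (@abse_measurable R setT) mEh) (fun y _ => abse_ge0 _).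
  by rewrite preimage_setT => ->; case/integrableP: ih.
have E1 : (\int[P]_t (EFin \o h \o phi) t =
    \int[P]_t fubini_F P (EFin \o h \o psi) t)%E.
  rewrite (integral12_prod_meas1 ipsi).
  have := integral_pushforward mphi mEh ih measurableT.
  rewrite preimage_setT => <-.
  have := integral_pushforward mpsi mEh ipsi measurableT.
  by rewrite preimage_setT => <-; exact: eqm.
have iF := integrable_fubini_F ipsi.
have Ffin := integrable_ae measurableT iF.
have mF := measurable_int _ iF.
have mfF : measurable_fun setT
    (EFin \o (fun t => \int[P]_(t' in setT) h (X t, Y t'))%R).
  by apply/measurable_EFinP; exact: measurableT_comp mF.
(* The inner integral is known to be finite only almost everywhere; there [fine] loses nothing. *)
have FE : ae_eq P setT (fubini_F P (EFin \o h \o psi))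
    (EFin \o (fun t => \int[P]_(t' in setT) h (X t, Y t'))%R).
  by apply: filterS Ffin => t Ft _ /=; rewrite /Rintegral fineK//; exact: Ft.
split.
  apply/integrableP; split => //.
  rewrite (ae_eq_integral (abse \o fubini_F P (EFin \o h \o psi)))//.
  - by case/integrableP: iF.
  - exact: measurableT_comp.
  - exact: measurableT_comp.
  - by apply: filterS FE => t H _; congr abse; exact/esym/(H I).
by rewrite /Rintegral; congr fine; rewrite [LHS]E1; exact: ae_eq_integral.
Qed.

Lemma cintegral_independent X Y (h : R * R -> R[i]) :
  measurable_fun setT X -> measurable_fun setT Y -> independent X Y ->
  cmeasurable h -> cintegrable P (fun t => h (X t, Y t)) ->
  cintegrable P (fun t => cintegral P setT (fun t' => h (X t, Y t'))) /\
  cintegral P setT (fun t => h (X t, Y t)) =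
  cintegral P setT (fun t => cintegral P setT (fun t' => h (X t, Y t'))).
Proof.
move=> mX mY iXY [mh1 mh2] [ih1 ih2].
have [i1 e1] := integral_independent mX mY iXY mh1 ih1.
have [i2 e2] := integral_independent mX mY iXY mh2 ih2.
by split=> //; apply: eqC.
Qed.

End IndependentPair.

(** * Independence of one variable from the information in the others *)

Section Cylinders.
Context d (T : measurableType d) (R : realType) (P : probability T R).
Variables (I : choiceType) (X : I -> {RV P >-> R}).
Hypothesis iX : mutually_independent X.
Variable K : pred I.

Definition cylinders : set (set T) :=
  [set A | exists J : seq I, exists E : I -> set R,
    [/\ {subset J <= K}, forall i, measurable (E i) &
        A = \bigcap_(i in [set` J]) (X i @^-1` E i)]].

Let mXE i (E : set R) : measurable E -> measurable (X i @^-1` E).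
Proof. by move=> mE; rewrite -[X in measurable X]setTI; exact: measurable_funP. Qed.

Lemma cylinders_measurable : cylinders `<=` measurable.
Proof.
move=> _ [J [E [_ mE ->]]]; rewrite bigcap_seq.
by apply: bigsetI_measurable => i _; exact: mXE.
Qed.

Lemma cylinders_setI : setI_closed cylinders.
Proof.
move=> _ _ [J1 [E1 [J1K mE1 ->]]] [J2 [E2 [J2K mE2 ->]]].
(* For an index in only one of the lists the other condition has to be void, hence [setT]. *)
exists (J1 ++ J2), (fun i => (if i \in J1 then E1 i else setT) `&`
  (if i \in J2 then E2 i else setT)); split.
- by move=> i; rewrite mem_cat => /orP[/J1K|/J2K].
- by move=> i; apply: measurableI; case: ifP.
apply/seteqP; split => [t [t1 t2] i /=|t H].
- rewrite mem_cat => /orP[] iJ; split.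
  + by rewrite iJ; exact: t1.
  + by case: ifP => // iJ2; exact: t2.
  + by case: ifP => // iJ1; exact: t1.
  + by rewrite iJ; exact: t2.
- split=> i /= iJ.
  + by have /= := H i; rewrite mem_cat iJ => /(_ isT)[].
  + by have /= := H i; rewrite mem_cat iJ orbT => /(_ isT)[].
Qed.

Lemma cylinders_preimage i (E : set R) : i \in K -> measurable E ->
  cylinders (X i @^-1` E).
Proof.
move=> iK mE; exists [:: i], (fun=> E); split => //.
  by move=> j; rewrite inE => /eqP ->.
by rewrite bigcap_seq big_seq1.
Qed.

(** With F fixed, both sides are finite measures in A. They agree on cylinders by mutual
    independence, and cylinders form a pi-system, so they agree on the generated sigma-algebra. *)
Lemma sigma_cylinders_independent i (F : set R) A : i \notin K ->
  measurable F -> <<s cylinders >> A ->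
  P (A `&` X i @^-1` F) = (P A * P (X i @^-1` F))%E.
Proof.
move=> iK mF sA; have mXF := mXE i mF.
pose p := NngNum (fine_ge0 (measure_ge0 P (X i @^-1` F))).
have pE : (p%:num%:E = P (X i @^-1` F))%E by rewrite /= fineK// fin_num_measure.
rewrite muleC -pE.
apply: (g_sigma_algebra_measure_unique cylinders cylinders_measurable (fun=> setT)
  _ _ (mrestr P mXF) (mscale p P) cylinders_setI) => //.
- by move=> _; exists [::], (fun=> setT); split => //; rewrite bigcap_seq big_nil.
- by rewrite bigcup_const.
- move=> _ [J [E [JK mE ->]]].
  (* [mutually_independent] speaks of duplicate-free lists only. *)
  have -> : [set` J] = [set` undup J].
    by apply/seteqP; split => j /=; rewrite mem_undup.
  have iJ : i \notin undup J by rewrite mem_undup; apply: contra iK => /JK.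
  (* One family with F placed at i, so that mutual independence along i :: undup J gives the joint
     event. *)
  pose E' j := if j == i then F else E j.
  have mE' j : measurable (E' j) by rewrite /E'; case: ifP.
  have U : uniq (i :: undup J) by rewrite /= iJ undup_uniq.
  have E'J j : j \in undup J -> E' j = E j.
    by move=> jJ; rewrite /E'; case: eqP => // ji; rewrite -ji jJ in iJ.
  have := iX U mE'; rewrite big_cons {2}/E' eqxx.
  under [in RHS]eq_big_seq => j jJ do rewrite E'J//.
  rewrite -(iX (undup_uniq J) mE) bigcap_seq big_cons /E' eqxx => H.
  change (P (\bigcap_(j in [set` undup J]) (X j @^-1` E j) `&` X i @^-1` F) =
    p%:num%:E * P (\bigcap_(j in [set` undup J]) (X j @^-1` E j)))%E.
  rewrite pE -H setIC; congr (P (_ `&` _)).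
  rewrite -bigcap_seq; apply: eq_bigcapr => j /= jJ.
  by case: eqP => // ji; rewrite -ji jJ in iJ.
- move=> _; change (P (setT `&` X i @^-1` F) < +oo)%E; rewrite setTI.
  by rewrite (le_lt_trans (probability_le1 _ _)) ?ltry.
Qed.

(* Measurability with respect to the information carried by the family [X i, i in K]. *)
Definition known (f : T -> R) :=
  measurable_fun setT (f : g_sigma_algebraType cylinders -> R).

Lemma known_measurable f : known f -> measurable_fun setT f.
Proof.
move=> kf mT S mS; have := kf measurableT S mS.
exact: (smallest_sub (@sigma_algebra_measurable _ T) cylinders_measurable).
Qed.

Lemma known_family i : i \in K -> known (X i).
Proof.
move=> iK mT S mS; rewrite setTI; apply: sub_sigma_algebra.
exact: cylinders_preimage.
Qed.

Lemma known_cst c : known (fun=> c).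
Proof. exact: measurable_cst. Qed.

Lemma knownD f g : known f -> known g -> known (fun t => f t + g t).
Proof. exact: measurable_funD. Qed.

Lemma knownB f g : known f -> known g -> known (fun t => f t - g t).
Proof. exact: measurable_funB. Qed.

Lemma knownM f g : known f -> known g -> known (fun t => f t * g t).
Proof. exact: measurable_funM. Qed.

Lemma known_max f g : known f -> known g -> known (fun t => Num.max (f t) (g t)).
Proof. exact: measurable_maxr. Qed.

Lemma known_independent f i : i \notin K -> known f -> independent P f (X i).
Proof.
move=> iK kf E F mE mF; apply: sigma_cylinders_independent => //.
by have := kf measurableT E mE; rewrite setTI.
Qed.

End Cylinders.

(** * Overshoot of a variable with rational transform *)

Section LaplaceEntire.
Context d (T : measurableType d) (R : realType) (P : probability T R).
Local Notation E := (cintegral P setT).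

Lemma cmeasurable_laplace (Z : T -> R) (s : R[i]) : measurable_fun setT Z ->
  cmeasurable (fun t => cexp (- (s * (Z t)%:C))).
Proof.
move=> mZ; apply: cmeasurable_cexp; apply: cmeasurableN.
by apply: cmeasurableM; [exact: cmeasurable_cst|exact: cmeasurable_real].
Qed.

(** The expectation of (1 - sZ/n)^n is, by binomial expansion, a polynomial in s whose coefficients
    are multiples of moments of Z. Boundedness of Z makes its distance to the transform uniform on
    discs. *)
Lemma entire_laplace (Z : T -> R) (M : R) : measurable_fun setT Z ->
  {ae P, forall t, `|Z t| <= M} ->
  entire (fun s => E (fun t => cexp (- (s * (Z t)%:C)))).
Proof.
move=> mZ ZM rho e e0.
(* b bounds |sZ| on the disc and K/n is the error in [cexp_approx]; n is chosen so that 2b <= n and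
   2K/n <= e, the last 2 coming from [cintegral_bound]. *)
pose b := `|rho| * `|M|.
have b0 : 0 <= b by rewrite mulr_ge0.
pose K := 4 * b ^+ 2 * expR b.
have K0 : 0 <= K by rewrite !mulr_ge0 ?sqr_ge0 ?expR_ge0.
pose n := (Num.truncn (2 * b + 2 * K / e)).+1.
have nE : 2 * b + 2 * K / e <= n%:R by rewrite ltW// truncnS_gt.
have q0 : 0 <= 2 * K / e by rewrite divr_ge0 ?mulr_ge0// ltW.
have bn : 2 * b <= n%:R by rewrite (le_trans _ nE)// lerDl.
have Kn : 2 * (K / n%:R) <= e.
  rewrite mulrA ler_pdivrMr ?ltr0n// -ler_pdivrMl// mulrC.
  by rewrite (le_trans _ nE)// lerDr mulr_ge0.
pose c k := E (fun t => (- (Z t)%:C / n%:R) ^+ k *+ 'C(n, k)).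
have mc k : cmeasurable (fun t => (- (Z t)%:C / n%:R) ^+ k *+ 'C(n, k)).
  under [X in cmeasurable X]eq_fun do rewrite -mulr_natr.
  apply: cmeasurableM; last exact: cmeasurable_cst.
  apply: cmeasurableX; apply: cmeasurableM; last exact: cmeasurable_cst.
  by apply: cmeasurableN; exact: cmeasurable_real.
have bZ : {ae P, forall t, normc (- (Z t)%:C / n%:R) <= `|M|}.
  apply: filterS ZM => t tM; rewrite normcM normcN normcR normcV normc_nat.
  rewrite ler_pdivrMr ?ltr0n// (le_trans tM)// (le_trans (ler_norm _))//.
  by rewrite ler_peMr// ler1n.
have ic k : cintegrable P (fun t => (- (Z t)%:C / n%:R) ^+ k *+ 'C(n, k)).
  apply: (bounded_cintegrable (C := `|M| ^+ k * 'C(n, k)%:R)) => //.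
  apply: filterS bZ => t tM; rewrite -mulr_natr normcM normc_nat normcX.
  by rewrite ler_wpM2r// lerXn2r ?nnegrE ?normc_ge0.
exists (\poly_(k < n.+1) c k) => s srho.
have -> : (\poly_(k < n.+1) c k).[s] =
    E (fun t => (1 + - (s * (Z t)%:C) / n%:R) ^+ n).
  rewrite horner_poly.
  transitivity (\sum_(k < n.+1)
      E (fun t => s ^+ k * ((- (Z t)%:C / n%:R) ^+ k *+ 'C(n, k)))).
    by apply: eq_bigr => k _; rewrite cintegralZl// mulrC.
  rewrite -cintegral_sum; last by move=> k; exact: cintegrableZl.
  apply: eq_cintegral => t; rewrite exprDn; apply: eq_bigr => k _.
  rewrite expr1n mul1r mulrnAr -exprMn; congr (_ ^+ _ *+ _).
  by ring.
have sZ : {ae P, forall t, normc (- (s * (Z t)%:C)) <= b}.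
  apply: filterS ZM => t tM; rewrite normcN normcM normcR ler_pM ?normc_ge0//.
    by rewrite (le_trans srho)// ler_norm.
  by rewrite (le_trans tM)// ler_norm.
have mq : cmeasurable (fun t => (1 + - (s * (Z t)%:C) / n%:R) ^+ n).
  apply: cmeasurableX; apply: cmeasurableD; first exact: cmeasurable_cst.
  apply: cmeasurableM; last exact: cmeasurable_cst.
  apply: cmeasurableN; apply: cmeasurableM; first exact: cmeasurable_cst.
  exact: cmeasurable_real.
have i1 : cintegrable P (fun t => cexp (- (s * (Z t)%:C))).
  apply: (bounded_cintegrable (C := expR b)).
    exact: cmeasurable_laplace.
  apply: filterS sZ => t tb; rewrite normc_cexp ler_expR.
  by rewrite (le_trans (ler_norm _))// (le_trans (normc_ge_Re _)).
have i2 : cintegrable P (fun t => (1 + - (s * (Z t)%:C) / n%:R) ^+ n).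
  apply: (bounded_cintegrable (C := (1 + b) ^+ n)) => //.
  apply: filterS sZ => t tb; rewrite normcX lerXn2r ?nnegrE ?normc_ge0 ?addr_ge0//.
  rewrite (le_trans (ler_normcD _ _))// normc1 lerD2l normcM normcV normc_nat.
  by rewrite ler_pdivrMr ?ltr0n// (le_trans tb)// ler_peMr// ler1n.
have -> : E (fun t => cexp (- (s * (Z t)%:C))) -
    E (fun t => (1 + - (s * (Z t)%:C) / n%:R) ^+ n) =
    E (fun t => cexp (- (s * (Z t)%:C)) +
      (-1) * (1 + - (s * (Z t)%:C) / n%:R) ^+ n).
  by rewrite cintegralD ?cintegralZl ?mulN1r//; exact: cintegrableZl.
apply: le_trans Kn; apply: cintegral_bound.
  apply: cmeasurableD; first exact: cmeasurable_laplace.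
  by apply: cmeasurableM => //; exact: cmeasurable_cst.
apply: filterS sZ => t tb; rewrite mulN1r.
apply: le_trans (cexp_approx _ _) _ => //.
  by rewrite (le_trans _ bn)// ler_wpM2l.
rewrite ler_wpM2r ?invr_ge0// /K; apply: ler_pM.
- by rewrite mulr_ge0 ?sqr_ge0.
- exact: expR_ge0.
- by rewrite ler_wpM2l// lerXn2r ?nnegrE ?normc_ge0.
- by rewrite ler_expR.
Qed.

End LaplaceEntire.

(** * Continuation of the overshoot transform from a fixed level x <= 0 *)

Section RationalOvershoot.
Context d (T : measurableType d) (R : realType) (P : probability T R).
Local Notation E := (cintegral P setT).
Variables (B : T -> R) (l : nat) (N : {poly R[i]}) (s_ : 'I_l -> R[i]).
Hypothesis mB : measurable_fun setT B.
Hypothesis B0 : {ae P, forall t, 0 <= B t}.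
Hypothesis hs : forall j, complex.Re (s_ j) < 0.
Hypothesis hN : (size N <= l)%N.
Hypothesis hBrat : forall s : R[i], 0 <= complex.Re s ->
  LST P B s = N.[s] / (DB s_).[s].

Local Notation D := (DB s_).

Lemma DB_neq0 s : 0 <= complex.Re s -> D.[s] != 0.
Proof.
move=> s0; rewrite /DB horner_prod; apply/prodf_neq0 => j _.
rewrite hornerXsubC subr_eq0; apply: contraTneq s0 => ->.
by rewrite -ltNge.
Qed.

Lemma size_DB : size D = l.+1.
Proof. by rewrite /DB size_prod_XsubC /index_enum -enumT size_enum_ord. Qed.

Definition over x s := E (fun t => cexp (- (s * (Num.max (x + B t) 0)%:C))).
Definition under x s := E (fun t => cexp (- (s * (Num.min (x + B t) 0)%:C))).

Let mover x s : cmeasurable (fun t => cexp (- (s * (Num.max (x + B t) 0)%:C))).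
Proof.
apply: cmeasurable_laplace; apply: measurable_maxr => //.
by apply: measurable_funD.
Qed.

Let munder x s : cmeasurable (fun t => cexp (- (s * (Num.min (x + B t) 0)%:C))).
Proof.
apply: cmeasurable_laplace; apply: measurable_minr => //.
by apply: measurable_funD.
Qed.

Lemma Re_Nmul (s : R[i]) (x : R) : complex.Re (- (s * x%:C)) = - (complex.Re s * x).
Proof. by rewrite ReN ReMr. Qed.

Let bover x s t : 0 <= complex.Re s ->
  normc (cexp (- (s * (Num.max (x + B t) 0)%:C))) <= 1.
Proof.
move=> s0; apply: normc_cexp_le1; rewrite Re_Nmul oppr_le0 mulr_ge0//.
by rewrite le_max lexx orbT.
Qed.

Let bunder x s t : complex.Re s <= 0 ->
  normc (cexp (- (s * (Num.min (x + B t) 0)%:C))) <= 1.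
Proof.
move=> s0; apply: normc_cexp_le1; rewrite Re_Nmul oppr_le0 mulr_le0//.
by rewrite ge_min lexx orbT.
Qed.

Let min_bound x : x <= 0 -> {ae P, forall t, `|Num.min (x + B t) 0| <= `|x|}.
Proof.
move=> x0; apply: filterS B0 => t Bt.
rewrite (ler0_norm x0) ler0_norm ?lerN2; last by rewrite ge_min lexx orbT.
by rewrite le_min x0 lerDl Bt.
Qed.

Lemma cexp_max_min (s : R[i]) (y : R) :
  cexp (- (s * (Num.max y 0)%:C)) + cexp (- (s * (Num.min y 0)%:C)) =
  1 + cexp (- (s * y%:C)).
Proof.
by case: (leP y 0) => _; rewrite mulr0 oppr0 cexp0// addrC.
Qed.

Lemma over_under x s : x <= 0 -> 0 <= complex.Re s ->
  D.[s] * over x s = D.[s] * (1 - under x s) + N.[s] * cexp (- (s * x%:C)).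
Proof.
move=> x0 s0.
have i1 : cintegrable P (fun t => cexp (- (s * (Num.max (x + B t) 0)%:C))).
  by apply: (bounded_cintegrable (C := 1)) => //; apply: aeW => t; exact: bover.
(* For Re s >= 0 this exponential has modulus at least 1, but B >= 0 keeps the minimum between x and
   0, so it stays bounded. *)
have i2 : cintegrable P (fun t => cexp (- (s * (Num.min (x + B t) 0)%:C))).
  apply: (bounded_cintegrable (C := expR (normc s * `|x|))) => //.
  apply: filterS (min_bound x0) => t tx; rewrite normc_cexp ler_expR.
  rewrite (le_trans (ler_norm _))// (le_trans (normc_ge_Re _))//.
  by rewrite normcN normcM normcR ler_wpM2l ?normc_ge0.
have iB : cintegrable P (fun t => cexp (- (s * (B t)%:C))).
  apply: (bounded_cintegrable (C := 1)); first exact: cmeasurable_laplace.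
  apply: filterS B0 => t Bt; apply: normc_cexp_le1.
  by rewrite Re_Nmul oppr_le0 mulr_ge0.
have e : over x s + under x s = 1 + cexp (- (s * x%:C)) * (N.[s] / D.[s]).
  rewrite -hBrat// /LST -cintegralZl// -(cintegralD i1 i2) -[X in X + E _](cintegral_cst P).
  rewrite -cintegralD; [|exact: cintegrable_cst|exact: cintegrableZl].
  apply: eq_cintegral => t; rewrite cexp_max_min -cexpD; congr (_ + cexp _).
  by rewrite rmorphD/=; ring.
have -> : over x s = 1 - under x s + cexp (- (s * x%:C)) * (N.[s] / D.[s]).
  by rewrite -[LHS](addrK (under x s)) e; ring.
by field; exact: DB_neq0.
Qed.

(** The growth bound comes from different sources: for Re s >= 0 the left side is D times [over],
    and for Re s <= 0 both [under] and e^{-sx} are bounded, the latter because x <= 0. *)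
Lemma under_interp x s : x <= 0 ->
  D.[s] * (1 - under x s) + N.[s] * cexp (- (s * x%:C)) =
  (interp l (fun z => D.[z] * over x z)).[s].
Proof.
move=> x0; pose H z := D.[z] * (1 - under x z) + N.[z] * cexp (- (z * x%:C)).
(* The nodes lie in Re z >= 0, where [over_under] identifies the two functions. *)
have -> : interp l (fun z => D.[z] * over x z) = interp l H.
  apply: eq_bigr => i _; congr (_ *: _); rewrite over_under//.
  by rewrite -(rmorph_nat (real_complex R))/=.
have normU z : complex.Re z <= 0 -> normc (under x z) <= 2.
  move=> z0; rewrite -[leRHS]mulr1; apply: cintegral_bound => //.
  by apply: aeW => t; exact: bunder.
have normO z : 0 <= complex.Re z -> normc (over x z) <= 2.
  move=> z0; rewrite -[leRHS]mulr1; apply: cintegral_bound => //.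
  by apply: aeW => t; exact: bover.
(* Here 3 = 1 + 2 bounds |1 - under| on the left and also covers |over| <= 2 on the right. *)
apply: (@liouville _ _ H (3 * l1norm D + l1norm N)).
  apply: entireD.
    apply: (@entire_mull R _ (fun z => 1 - under x z)).
    have -> : (fun z => 1 - under x z) =
        (fun z => (1 : {poly R[i]}).[z] + (-1 : {poly R[i]}).[z] * under x z).
      by apply/funext => z; rewrite hornerN hornerC mulN1r.
    apply: entireD; first exact: entire_poly.
    apply: entire_mull; apply: entire_laplace (min_bound x0).
    by apply: measurable_minr => //; exact: measurable_funD.
  apply: (@entire_mull R _ (fun z => cexp (- (z * x%:C)))).
  have -> : (fun z => cexp (- (z * x%:C))) = (fun z => E (fun=> cexp (- (z * x%:C)))).
    by apply/funext => z; rewrite cintegral_cst.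
  by apply: (@entire_laplace _ _ _ P (fun=> x) `|x|) => //; exact: aeW.
move=> z.
have n0 : 0 <= (1 + normc z) ^+ l by rewrite exprn_ge0// addr_ge0// normc_ge0.
have nD : normc D.[z] <= l1norm D * (1 + normc z) ^+ l.
  by apply: normc_horner; rewrite size_DB.
have nN : normc N.[z] <= l1norm N * (1 + normc z) ^+ l.
  by apply: normc_horner; rewrite (leq_trans hN).
have lN := l1norm_ge0 N; have lD := l1norm_ge0 D.
have [z0|/ltW z0] := leP 0 (complex.Re z).
  rewrite /H -over_under// normcM mulrDl.
  apply: ler_wpDr; first by rewrite mulr_ge0.
  rewrite [_ * l1norm _]mulrC -mulrA [3 * _]mulrC mulrA ler_pM ?normc_ge0//.
  by rewrite (le_trans (normO z z0))// ler_nat.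
rewrite /H (le_trans (ler_normcD _ _))// 2!normcM mulrDl lerD//.
  rewrite [_ * l1norm _]mulrC -mulrA [3 * _]mulrC mulrA ler_pM ?normc_ge0//.
  rewrite (le_trans (ler_normcB _ _))// normc1.
  by have := normU z z0; lra.
rewrite -[leRHS]mulr1; apply: ler_pM; rewrite ?normc_ge0//.
by apply: normc_cexp_le1; rewrite Re_Nmul oppr_le0 mulr_le0.
Qed.

End RationalOvershoot.

(** * Generating series *)

Section ComplexLimits.
Variable R : realType.
Implicit Types (u v : nat -> R[i]) (l : R[i]).

(** The norm of R[i] takes its values in R[i]; the real-valued [normc] makes squeezing and real
    limits available. *)
Definition cvgC u l := normc (u n - l) @[n --> \oo] --> (0 : R).

Lemma cvgC_lim u l : cvgC u l -> limn (u : nat -> R[i]^o) = l.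
Proof.
move=> ul; apply: (@cvg_lim _ (@norm_hausdorff _ R[i]^o)).
(* In the order of R[i], 0 < e forces e to be real. *)
apply/(@cvgrPdist_lt _ R[i]^o) => -[e ei]; rewrite ltcE/= => /andP[/eqP -> e0].
have ue := @cvgr0_norm_lt _ _ _ _ _ _ ul e e0.
near=> n; rewrite normrC ltcR normcBC -[normc _]ger0_norm ?normc_ge0//.
by near: n; exact: ue.
Unshelve. all: by end_near. Qed.

Lemma cvgC_le u l (v : nat -> R) : (forall n, normc (u n - l) <= v n) ->
  v @ \oo --> (0 : R) -> cvgC u l.
Proof.
move=> uv v0; apply: (squeeze_cvgr _ (cvg_cst 0) v0).
by apply: nearW => n; rewrite normc_ge0 uv.
Qed.

Lemma cvgC_cst l : cvgC (fun=> l) l.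
Proof.
apply: (@cvgC_le _ _ (fun=> 0)); last exact: cvg_cst.
by move=> n; rewrite subrr normc0.
Qed.

Lemma cvgCD u v l m : cvgC u l -> cvgC v m -> cvgC (fun n => u n + v n) (l + m).
Proof.
move=> ul vm; apply: (@cvgC_le _ _ (fun n => normc (u n - l) + normc (v n - m))).
  by move=> n; rewrite opprD addrACA ler_normcD.
by rewrite -[0](addr0 0); exact: cvgD.
Qed.

Lemma cvgCZ u l c : cvgC u l -> cvgC (fun n => c * u n) (c * l).
Proof.
move=> ul; apply: (@cvgC_le _ _ (fun n => normc c * normc (u n - l))).
  by move=> n; rewrite -mulrBr normcM.
by rewrite -[0](mulr0 (normc c)); exact: cvgMl_tmp.
Qed.

Lemma cvgC_sum (I : Type) (r : seq I) (u_ : I -> nat -> R[i]) (l_ : I -> R[i]) :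
  (forall i, cvgC (u_ i) (l_ i)) ->
  cvgC (fun n => \sum_(i <- r) u_ i n) (\sum_(i <- r) l_ i).
Proof.
move=> ul; elim: r => [|i r IHr].
  under [X in cvgC X]eq_fun do rewrite big_nil.
  by rewrite big_nil; exact: cvgC_cst.
under [X in cvgC X]eq_fun do rewrite big_cons.
by rewrite big_cons; exact: cvgCD.
Qed.

Lemma cvgC_unique u l m : cvgC u l -> cvgC u m -> l = m.
Proof. by move=> /cvgC_lim <- /cvgC_lim <-. Qed.

Lemma cvgCS u l : cvgC u l -> cvgC (fun n => u n.+1) l.
Proof. by move=> ul; rewrite /cvgC (cvg_shiftS (fun n => normc (u n - l))). Qed.

Lemma cvgC_geo u l (r K : R) : 0 < r < 1 ->
  (forall n, normc (u n - l) <= K * r ^+ n) -> cvgC u l.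
Proof.
move=> /andP[r0 r1] ul; apply: (cvgC_le ul).
by apply: cvg_geometric; rewrite gtr0_norm.
Qed.

Lemma cvgC_horner_interp n (u_ : nat -> R[i] -> R[i]) (f : R[i] -> R[i]) s :
  (forall i : 'I_n.+1, cvgC (u_ ^~ i%:R) (f i%:R)) ->
  cvgC (fun m => (interp n (u_ m)).[s]) (interp n f).[s].
Proof.
move=> uf; rewrite /interp horner_sum.
under [X in cvgC X]eq_fun do rewrite horner_sum.
apply: cvgC_sum => i; rewrite hornerZ mulrC.
by under [X in cvgC X]eq_fun do rewrite hornerZ mulrC; exact: cvgCZ.
Qed.

End ComplexLimits.

(** * Generating series with geometric remainder *)

Section GeneratingSeries.
Variable R : realType.
Variable r : R.
Hypothesis hr : 0 < r < 1.

Let r0 : 0 < r. Proof. by case/andP: hr. Qed.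
Let r1 : r < 1. Proof. by case/andP: hr. Qed.

(** The rate is explicit because it serves twice: at n = 0 it bounds the sum itself, and its
    dependence on the bound C alone makes the convergence uniform in parameters. *)
Lemma generating_series_rate_real (a : nat -> R) C : (forall i, `|a i| <= C) ->
  exists L, forall n, `|\sum_(i < n) r ^+ i * a i - L| <= C / (1 - r) * r ^+ n.
Proof.
move=> aC; have C0 : 0 <= C := le_trans (normr_ge0 _) (aC 0%N).
have r1' : 0 < 1 - r by rewrite subr_gt0.
have tC i : `|r ^+ i * a i| <= C * r ^+ i.
  by rewrite normrM normrX (gtr0_norm r0) mulrC ler_wpM2r// exprn_ge0// ltW.
have cvS : cvgn (series (fun i => r ^+ i * a i)).
  apply: normed_cvg; apply: (@series_le_cvg R _ (geometric C r)).
  - by move=> n /=.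
  - by move=> n /=; rewrite mulr_ge0// exprn_ge0// ltW.
  - by move=> n /=; exact: tC.
  - by apply: is_cvg_geometric_series; rewrite gtr0_norm.
have tail n k : `|\sum_(i < n) r ^+ i * a i - \sum_(i < n + k) r ^+ i * a i| <=
    C / (1 - r) * r ^+ n.
  rewrite big_split_ord/= opprD addrA subrr add0r normrN.
  rewrite (le_trans (ler_norm_sum _ _ _))//.
  rewrite (le_trans (y := \sum_(i < k) C * r ^+ n * r ^+ i))//.
    by apply: ler_sum => i _; rewrite (le_trans (tC _))// exprD mulrA.
  rewrite -mulr_sumr -[X in _ <= X]mulrA [_^-1 * _]mulrC mulrA.
  rewrite ler_wpM2l ?mulr_ge0 ?exprn_ge0 ?(ltW r0)//.
  rewrite -[leRHS]div1r ler_pdivlMr//.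
  have := subrX1 r k; have : 0 <= r ^+ k by rewrite exprn_ge0// ltW.
  by move: (\sum_(i < k) _) (r ^+ k) => S rk; lra.
exists (limn (series (fun i => r ^+ i * a i))) => n.
have c : `|\sum_(i < n) r ^+ i * a i - series (fun i => r ^+ i * a i) m| @[m --> \oo]
    --> `|\sum_(i < n) r ^+ i * a i - limn (series (fun i => r ^+ i * a i))|.
  by apply: cvg_norm; apply: cvgB => //; exact: cvg_cst.
apply: (cvgr_to_le c); near=> m.
have nm : (n <= m)%N by near: m; exact: nbhs_infty_ge.
by rewrite -(subnKC nm) seriesEord; exact: tail.
Unshelve. all: by end_near. Qed.

Lemma generating_series_rate (c : nat -> R[i]) C : (forall i, normc (c i) <= C) ->
  exists L, forall n,
    normc (\sum_(i < n) r%:C ^+ i * c i - L) <= 2 * C / (1 - r) * r ^+ n.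
Proof.
move=> cC.
have [L1 h1] := @generating_series_rate_real (fun i => complex.Re (c i)) C
  (fun i => le_trans (normc_ge_Re _) (cC i)).
have [L2 h2] := @generating_series_rate_real (fun i => complex.Im (c i)) C
  (fun i => le_trans (normc_ge_Im _) (cC i)).
exists (L1 +i* L2) => n; apply: le_trans (normc_leD _) _.
rewrite ReD ImD Re_sum Im_sum ReN ImN /=.
have -> : \sum_(i < n) complex.Re (r%:C ^+ i * c i) =
    \sum_(i < n) r ^+ i * complex.Re (c i).
  by apply: eq_bigr => i _; rewrite -rmorphXn/= ReM /= mul0r subr0.
have -> : \sum_(i < n) complex.Im (r%:C ^+ i * c i) =
    \sum_(i < n) r ^+ i * complex.Im (c i).
  by apply: eq_bigr => i _; rewrite -rmorphXn/= ImM /= mul0r addr0.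
rewrite (le_trans (lerD (h1 n) (h2 n)))//.
by rewrite le_eqVlt; apply/orP; left; apply/eqP; ring.
Qed.

Context d (T : measurableType d) (P : probability T R).
Variable X : nat -> T -> R.

Lemma U_rate s C : (forall i, normc (LST P (X i) s) <= C) -> forall n,
  normc (\sum_(i < n) r%:C ^+ i * LST P (X i) s - U P X r s) <=
  2 * C / (1 - r) * r ^+ n.
Proof.
move=> XC; have [L hL] := generating_series_rate XC.
suff -> : U P X r s = L by [].
rewrite /U; apply: cvgC_lim; apply: (cvgC_geo hr) => n.
by rewrite seriesEord; exact: hL.
Qed.

Lemma cvgC_U s C : (forall i, normc (LST P (X i) s) <= C) ->
  cvgC (fun n => \sum_(i < n) r%:C ^+ i * LST P (X i) s) (U P X r s).
Proof. by move=> /U_rate XC; exact: cvgC_geo hr XC. Qed.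

(** The difference of the two series is again a generating series, with coefficients bounded by e;
    the rate at n = 0 bounds its sum. *)
Lemma U_lipschitz s z C : (forall i, normc (LST P (X i) s) <= C) ->
  (forall i, normc (LST P (X i) z) <= C) -> forall e,
  (forall i, normc (LST P (X i) s - LST P (X i) z) <= e) ->
  normc (U P X r s - U P X r z) <= 2 * e / (1 - r).
Proof.
move=> sC zC e se; have [L hL] := generating_series_rate se.
have -> : U P X r s - U P X r z = L.
  apply: (@cvgC_unique _ _ _ _ _ (cvgC_geo hr hL)).
  have := cvgCD (cvgC_U sC) (cvgCZ (-1) (cvgC_U zC)); rewrite mulN1r.
  congr cvgC; apply/funext => n; rewrite mulN1r -sumrB.
  by apply: eq_bigr => i _; rewrite mulrBr.
by have := hL 0%N; rewrite big_ord0 sub0r normcN expr0 mulr1.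
Qed.

End GeneratingSeries.

Section LaplaceContinuity.
Context d (T : measurableType d) (R : realType) (P : probability T R).

(** With y = - Z >= 0, half of the decay e^{-del y} is spent on e^{|s - z| y}; the other half
    absorbs the factor y, since y e^{-del y / 2} <= 2/del. The constant is the same for every Z, so
    the estimate passes to generating series. *)
Lemma LST_lipschitz (Z : T -> R) (s z : R[i]) (del : R) :
  measurable_fun setT Z -> (forall t, Z t <= 0) -> 0 < del ->
  complex.Re z <= - del -> normc (s - z) <= del / 2 ->
  normc (LST P Z s - LST P Z z) <= 12 / del * normc (s - z).
Proof.
move=> mZ Z0 del0 zd szd.
have pt t : normc (cexp (- (s * (Z t)%:C)) + (-1) * cexp (- (z * (Z t)%:C))) <=
    6 / del * normc (s - z).
  set y := - Z t; have y0 : 0 <= y by rewrite oppr_ge0.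
  have -> : (Z t)%:C = - y%:C by rewrite -rmorphN opprK.
  have -> : cexp (- (s * - y%:C)) + -1 * cexp (- (z * - y%:C)) =
      cexp (z * y%:C) * (cexp ((s - z) * y%:C) - 1).
    rewrite mulrBr mulr1 -cexpD !mulrN !opprK mulN1r; congr (cexp _ - _).
    by ring.
  rewrite normcM normc_cexp ReMr.
  have h : normc ((s - z) * y%:C) = normc (s - z) * y by rewrite normcM normcR ger0_norm.
  have e1 := normc_cexpB1 ((s - z) * y%:C); rewrite h in e1.
  apply: (le_trans (ler_wpM2l (expR_ge0 _) e1)).
  have -> : expR (complex.Re z * y) * (3 * (normc (s - z) * y) * expR (normc (s - z) * y)) =
      3 * normc (s - z) * (y * expR (complex.Re z * y + normc (s - z) * y)).
    by rewrite expRD; ring.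
  have -> : 6 / del * normc (s - z) = 3 * normc (s - z) * (2 / del) by ring.
  rewrite ler_wpM2l ?mulr_ge0 ?normc_ge0//.
  have e2 : expR (complex.Re z * y + normc (s - z) * y) <= expR (- (del / 2 * y)).
    rewrite ler_expR -mulrDl -mulNr ler_wpM2r//; lra.
  apply: (le_trans (ler_wpM2l y0 e2)).
  have e3 := expR_ge1Dx (del / 2 * y).
  rewrite expRN ler_pdivrMr ?expR_gt0//.
  apply: le_trans (ler_wpM2l _ e3); last by rewrite divr_ge0// ltW.
  have -> : 2 / del * (1 + del / 2 * y) = 2 / del + y by field; rewrite gt_eqF.
  by rewrite lerDr divr_ge0// ltW.
have b v t : complex.Re v <= 0 -> normc (cexp (- (v * (Z t)%:C))) <= 1.
  by move=> v0; apply: normc_cexp_le1; rewrite Re_Nmul oppr_le0 mulr_le0.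
have ms := cmeasurable_laplace s mZ; have mz := cmeasurable_laplace z mZ.
have z0 : complex.Re z <= 0 by lra.
have s0 : complex.Re s <= 0.
  have := le_trans (ler_norm _) (normc_ge_Re (s - z)); rewrite ReD ReN; lra.
have i1 := bounded_cintegrable ms (aeW P (fun t => b s t s0)).
have i2 := bounded_cintegrable mz (aeW P (fun t => b z t z0)).
have -> : LST P Z s - LST P Z z =
  cintegral P setT (fun t => cexp (- (s * (Z t)%:C)) + (-1) * cexp (- (z * (Z t)%:C))).
  by rewrite cintegralD ?cintegralZl ?mulN1r//; exact: cintegrableZl.
have -> : 12 / del * normc (s - z) = 2 * (6 / del * normc (s - z)) by ring.
apply: cintegral_bound; last exact: aeW.
by apply: cmeasurableD => //; apply: cmeasurableM => //; exact: cmeasurable_cst.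
Qed.

End LaplaceContinuity.

(** * One step of the recursion *)

Section Transfer.
Context d (T : measurableType d) (R : realType) (P : probability T R).
Local Notation E := (cintegral P setT).

Lemma measurable_RV (X : {RV P >-> R}) : measurable_fun setT X.
Proof. exact: measurable_funP. Qed.

Lemma ae_identically_distributed (X : nat -> {RV P >-> R}) (S : set R) n :
  identically_distributed X -> measurable S ->
  {ae P, forall t, S (X 0%N t)} -> {ae P, forall t, S (X n t)}.
Proof.
move=> iX mS [N0 [mN0 PN0 sN0]].
have mXC k : measurable (X k @^-1` (~` S)).
  by rewrite -[Y in measurable Y]setTI; apply: measurable_RV => //; exact: measurableC.
exists (X n @^-1` (~` S)); split => //.
have := iX n _ (measurableC mS); rewrite /distribution /pushforward => ->.
by apply: (subset_measure0 _ mN0 sN0 PN0); exact: mXC.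
Qed.

Lemma cintegral_distribution (X : {RV P >-> R}) (f : R -> R[i]) :
  cmeasurable f -> cintegrable P (fun t => f (X t)) ->
  cintegral (distribution P X) setT f = E (fun t => f (X t)).
Proof.
move=> [mf1 mf2] [i1 i2]; apply: eqC => /=; congr fine.
- by rewrite integral_distribution//; exact/measurable_EFinP.
- by rewrite integral_distribution//; exact/measurable_EFinP.
Qed.

Lemma cintegral_identically_distributed (X : nat -> {RV P >-> R}) (f : R -> R[i]) n :
  identically_distributed X -> cmeasurable f ->
  cintegrable P (fun t => f (X n t)) -> cintegrable P (fun t => f (X 0%N t)) ->
  E (fun t => f (X n t)) = E (fun t => f (X 0%N t)).
Proof.
move=> iX mf i1 i2; rewrite -!cintegral_distribution//.
by apply: eqC => /=; congr fine; apply: eq_measure_integral => A mA _; exact: iX.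
Qed.

(** F is controlled only for y <= 0: a generating series at s y with y > 0 may diverge. It is traded
    for a function f that is measurable everywhere, and the law of V gives the positive half-line no
    mass. *)
Lemma cintegral_negative (X : {RV P >-> R}) (F f : R -> R[i]) :
  {ae P, forall t, X t < 0} -> cmeasurable f -> cintegrable P (fun t => f (X t)) ->
  (forall y, y <= 0 -> F y = f y) ->
  cintegral (distribution P X) `]-oo, 0] F = E (fun t => f (X t)).
Proof.
move=> X0 mf fi Ff; rewrite -cintegral_distribution//.
have m0 : measurable (`]-oo, (0 : R)]%classic) by [].
have [mf1 mf2] := mf.
have key (k h : R -> R) : measurable_fun setT h -> (forall y, y <= 0 -> k y = h y) ->
    (\int[distribution P X]_(y in `]-oo, 0]) k y)%R =
    (\int[distribution P X]_(y in setT) h y)%R.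
  move=> mh kh; rewrite (@eq_Rintegral _ _ _ _ _ h); last first.
    by move=> y; rewrite inE/= in_itv/= => y0; exact: kh.
  rewrite Rintegral_mkcond /Rintegral; congr fine; apply: ae_eq_integral => //.
  - by apply/measurable_EFinP/measurable_restrict => //; rewrite setTI; exact: measurable_funS mh.
  - exact/measurable_EFinP.
  - have nX : {ae P, forall t, (`]-oo, (0 : R)]%classic) (X t)}.
      by apply: filterS X0 => t Xt; rewrite /= in_itv/= ltW.
    have mXC : measurable (X @^-1` (~` `]-oo, (0 : R)]%classic)).
      rewrite -[Y in measurable Y]setTI; apply: measurable_RV => //.
      exact: measurableC.
    exists (~` `]-oo, (0 : R)]%classic); split => //; first exact: measurableC.
      case: nX => N0 [mN0 PN0 sN0].
      by apply: (subset_measure0 mXC mN0 sN0 PN0).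
    by move=> y H; apply: contra_not H => /= y0 _; rewrite patchE mem_set.
by apply: eqC => /=; apply: key => // y y0; rewrite Ff.
Qed.

End Transfer.

Lemma independent_sym d (T : measurableType d) (R : realType) (P : probability T R)
  (X Y : T -> R) : independent P X Y -> independent P Y X.
Proof. by move=> XY E F mE mF; rewrite setIC XY// muleC. Qed.

Section OneStep.
Context d (T : measurableType d) (R : realType) (P : probability T R).
Local Notation E := (cintegral P setT).
Variables (V A B : nat -> {RV P >-> R}) (l : nat) (N : {poly R[i]}) (s_ : 'I_l -> R[i]).
Hypothesis hindep : mutually_independent (inputs V A B).
Hypothesis hidV : identically_distributed V.
Hypothesis hidA : identically_distributed A.
Hypothesis hidB : identically_distributed B.
Hypothesis hA : {ae P, forall t, 0 <= A 0%N t}.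
Hypothesis hB : {ae P, forall t, 0 <= B 0%N t}.
Hypothesis hV : {ae P, forall t, V 0%N t < 0}.
Hypothesis hs : forall j, complex.Re (s_ j) < 0.
Hypothesis hN : (size N <= l)%N.
Hypothesis hBrat : forall s : R[i], 0 <= complex.Re s ->
  LST P (B 0%N) s = N.[s] / (DB s_).[s].
Variable w : R.
Hypothesis hw : 0 <= w.

Local Notation D := (DB s_).
Local Notation W := (W w V A B).
Local Notation Wstar := (Wstar w V A B).
Local Notation X n := (fun t => V n t * W n t - A n t).

Let hAn n : {ae P, forall t, 0 <= A n t}.
Proof.
have : {ae P, forall t, [set` `[(0 : R), +oo[] (A n t)}.
  apply: ae_identically_distributed => //.
  by apply: filterS hA => t At; rewrite /= in_itv/= At.
by move=> h; apply: filterS h => t; rewrite /= in_itv/= andbT.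
Qed.

Let hBn n : {ae P, forall t, 0 <= B n t}.
Proof.
have : {ae P, forall t, [set` `[(0 : R), +oo[] (B n t)}.
  apply: ae_identically_distributed => //.
  by apply: filterS hB => t Bt; rewrite /= in_itv/= Bt.
by move=> h; apply: filterS h => t; rewrite /= in_itv/= andbT.
Qed.

Lemma ae_V_lt0 n : {ae P, forall t, V n t < 0}.
Proof.
have : {ae P, forall t, [set` `]-oo, (0 : R)[] (V n t)}.
  exact: ae_identically_distributed.
by move=> h; apply: filterS h => t; rewrite /= in_itv/=.
Qed.

Lemma W_ge0 n t : 0 <= W n t.
Proof. by case: n => //= n; rewrite le_max lexx orbT. Qed.

Lemma Wstar_le0 n t : Wstar n t <= 0.
Proof. by rewrite /Defs.Wstar ge_min lexx orbT. Qed.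

Lemma WS_E n t : W n.+1 t = Num.max (X n t + B n t) 0.
Proof. by rewrite /= addrA addrAC. Qed.

Lemma Wstar_E n t : Wstar n t = Num.min (X n t + B n t) 0.
Proof. by rewrite /Defs.Wstar addrA addrAC. Qed.

(** Time index of an input: W n is built from inputs of smaller index, which makes it independent of
    each input of index n. *)
Definition step_of (k : nat + nat + nat) : nat :=
  match k with inl (inl n) => n | inl (inr n) => n | inr n => n end.

Lemma known_W (K : pred (nat + nat + nat)) n :
  (forall k, (step_of k < n)%N -> k \in K) -> known (inputs V A B) K (W n).
Proof.
elim: n => [|n IHn] KS; first exact: known_cst.
apply: known_max; last exact: known_cst.
apply: knownD; [apply: knownM|apply: knownB].
- by apply: (@known_family _ _ _ _ _ (inputs V A B) K (inl (inl n))); exact: KS.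
- by apply: IHn => k kn; apply: KS; exact: leqW.
- by apply: (@known_family _ _ _ _ _ (inputs V A B) K (inr n)); exact: KS.
- by apply: (@known_family _ _ _ _ _ (inputs V A B) K (inl (inr n))); exact: KS.
Qed.

Let indep_WV n : independent P (V n) (W n).
Proof.
apply: independent_sym.
apply: (@known_independent _ _ _ _ _ _ hindep
  [pred k | (step_of k < n)%N] _ (inl (inl n))); first by rewrite inE ltnn.
exact: known_W.
Qed.

Let indep_VWA n : independent P (fun t => V n t * W n t) (A n).
Proof.
pose K : pred (nat + nat + nat) :=
  [pred k | (step_of k < n)%N || (k == inl (inl n))].
apply: (@known_independent _ _ _ _ _ _ hindep K _ (inl (inr n))).
  by rewrite !inE ltnn.
apply: knownM; last by apply: known_W => k; rewrite !inE => ->.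
by apply: (@known_family _ _ _ _ _ (inputs V A B) K (inl (inl n))); rewrite !inE eqxx orbT.
Qed.

Let indep_XB n : independent P (X n) (B n).
Proof.
pose K : pred (nat + nat + nat) :=
  [pred k | [|| (step_of k < n)%N, k == inl (inl n) | k == inl (inr n)]].
apply: (@known_independent _ _ _ _ _ _ hindep K _ (inr n)).
  by rewrite !inE ltnn.
apply: knownB; first apply: knownM.
- by apply: (@known_family _ _ _ _ _ (inputs V A B) K (inl (inl n))); rewrite !inE eqxx orbT.
- by apply: known_W => k; rewrite !inE => ->.
- by apply: (@known_family _ _ _ _ _ (inputs V A B) K (inl (inr n))); rewrite !inE eqxx !orbT.
Qed.

Lemma measurable_W n : measurable_fun setT (W n).
Proof.
by apply: (@known_measurable _ _ _ _ _ (inputs V A B) xpredT); exact: known_W.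
Qed.

Let measurable_VW n : measurable_fun setT (fun t => V n t * W n t).
Proof. by apply: measurable_funM; [exact: measurable_RV|exact: measurable_W]. Qed.

Let measurable_X n : measurable_fun setT (X n).
Proof. by apply: measurable_funB => //; exact: measurable_RV. Qed.

Lemma measurable_Wstar n : measurable_fun setT (Wstar n).
Proof.
rewrite (_ : Wstar n = (fun t => Num.min (X n t + B n t) 0)).
  apply: measurable_minr => //.
  by apply: measurable_funD; [exact: measurable_X|exact: measurable_RV].
by apply/funext => t; rewrite Wstar_E.
Qed.

Let X_le0 n : {ae P, forall t, X n t <= 0}.
Proof.
apply: filterS2 (ae_V_lt0 n) (hAn n) => t Vt At.
by rewrite subr_le0 (le_trans _ At)// mulr_le0_ge0 ?W_ge0// ltW.
Qed.

Lemma bounded_LST_W n s : 0 <= complex.Re s -> normc (LST P (W n) s) <= 2.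
Proof.
move=> s0; rewrite -[leRHS]mulr1; apply: cintegral_bound.
  by apply: cmeasurable_laplace; exact: measurable_W.
apply: aeW => t; apply: normc_cexp_le1.
by rewrite Re_Nmul oppr_le0 mulr_ge0// W_ge0.
Qed.

Lemma bounded_LST_Wstar n s : complex.Re s <= 0 -> normc (LST P (Wstar n) s) <= 2.
Proof.
move=> s0; rewrite -[leRHS]mulr1; apply: cintegral_bound.
  by apply: cmeasurable_laplace; exact: measurable_Wstar.
apply: aeW => t; apply: normc_cexp_le1.
by rewrite Re_Nmul oppr_le0 mulr_le0// Wstar_le0.
Qed.

Lemma LST_Bn n s : 0 <= complex.Re s -> LST P (B n) s = N.[s] / D.[s].
Proof.
move=> s0; rewrite -hBrat//.
have i k : cintegrable P (fun t => cexp (- (s * (B k t)%:C))).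
  apply: (bounded_cintegrable (C := 1)).
    by apply: cmeasurable_laplace; exact: measurable_RV.
  apply: filterS (hBn k) => t Bt; apply: normc_cexp_le1.
  by rewrite Re_Nmul oppr_le0 mulr_ge0.
apply: (@cintegral_identically_distributed _ _ _ _ B
  (fun b => cexp (- (s * b%:C)))) => //.
exact: (@cmeasurable_laplace _ _ _ id).
Qed.

Lemma LST_An n s : complex.Re s <= 0 -> LST P (A n) (- s) = LST P (A 0%N) (- s).
Proof.
move=> s0.
have i k : cintegrable P (fun t => cexp (- (- s * (A k t)%:C))).
  apply: (bounded_cintegrable (C := 1)).
    by apply: cmeasurable_laplace; exact: measurable_RV.
  apply: filterS (hAn k) => t At; apply: normc_cexp_le1.
  by rewrite Re_Nmul oppr_le0 mulr_ge0// ReN oppr_ge0.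
apply: (@cintegral_identically_distributed _ _ _ _ A
  (fun b => cexp (- (- s * b%:C)))) => //.
exact: (@cmeasurable_laplace _ _ _ id).
Qed.

Lemma LST_WS n s : 0 <= complex.Re s ->
  cintegrable P (fun t => over P (B n) (X n t) s) /\
  LST P (W n.+1) s = E (fun t => over P (B n) (X n t) s).
Proof.
move=> s0.
have := @cintegral_independent _ _ _ P (X n) (B n)
  (fun z => cexp (- (s * (Num.max (z.1 + z.2) 0)%:C)))
  (measurable_X n) (measurable_RV _) (indep_XB n).
have mh : cmeasurable (fun z : R * R => cexp (- (s * (Num.max (z.1 + z.2) 0)%:C))).
  apply: cmeasurable_laplace; apply: measurable_maxr => //.
  exact: measurable_funD.
have mXB : measurable_fun setT (fun t => (X n t, B n t)).
  by apply: measurable_fun_pair; [exact: measurable_X|exact: measurable_RV].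
have i1 : cintegrable P (fun t => cexp (- (s * (Num.max (X n t + B n t) 0)%:C))).
  apply: (bounded_cintegrable (C := 1)); first exact: (cmeasurable_comp mh mXB).
  apply: aeW => t; apply: normc_cexp_le1.
  by rewrite Re_Nmul oppr_le0 mulr_ge0// le_max lexx orbT.
move=> /(_ mh i1)[i2 e]; split => //.
by rewrite -[RHS]e; apply: eq_cintegral => t; rewrite WS_E.
Qed.

Lemma LST_WstarE n s : complex.Re s <= 0 ->
  cintegrable P (fun t => under P (B n) (X n t) s) /\
  LST P (Wstar n) s = E (fun t => under P (B n) (X n t) s).
Proof.
move=> s0.
have := @cintegral_independent _ _ _ P (X n) (B n)
  (fun z => cexp (- (s * (Num.min (z.1 + z.2) 0)%:C)))
  (measurable_X n) (measurable_RV _) (indep_XB n).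
have mh : cmeasurable (fun z : R * R => cexp (- (s * (Num.min (z.1 + z.2) 0)%:C))).
  apply: cmeasurable_laplace; apply: measurable_minr => //.
  exact: measurable_funD.
have mXB : measurable_fun setT (fun t => (X n t, B n t)).
  by apply: measurable_fun_pair; [exact: measurable_X|exact: measurable_RV].
have i1 : cintegrable P (fun t => cexp (- (s * (Num.min (X n t + B n t) 0)%:C))).
  apply: (bounded_cintegrable (C := 1)); first exact: (cmeasurable_comp mh mXB).
  apply: aeW => t; apply: normc_cexp_le1.
  by rewrite Re_Nmul oppr_le0 mulr_le0// ge_min lexx orbT.
move=> /(_ mh i1)[i2 e]; split => //.
by rewrite -[RHS]e; apply: eq_cintegral => t; rewrite Wstar_E.
Qed.

(** A n is split off first, being independent of V n W n. Then W n is integrated with V n held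
    fixed, so that its transform is taken at s V n, almost surely in the right half-plane. *)
Lemma LST_X n s : complex.Re s <= 0 ->
  cintegrable P (fun t => cexp (- (s * (X n t)%:C))) /\
  [/\ cintegrable P (fun t => LST P (W n) (s * (V n t)%:C)) &
      E (fun t => cexp (- (s * (X n t)%:C))) =
      LST P (A 0%N) (- s) * E (fun t => LST P (W n) (s * (V n t)%:C))].
Proof.
move=> s0.
have mV := measurable_RV (V n); have mA := measurable_RV (A n).
have mW := measurable_W n.
have bVW : {ae P, forall t, normc (cexp (- (s * (V n t * W n t)%:C))) <= 1}.
  apply: filterS (ae_V_lt0 n) => t Vt; apply: normc_cexp_le1.
  by rewrite Re_Nmul oppr_le0 mulr_le0// mulr_le0_ge0 ?W_ge0// ltW.
have mh1 : cmeasurable (fun z : R * R => cexp (- (s * (z.1 * z.2)%:C))).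
  by apply: cmeasurable_laplace; exact: measurable_funM.
have iVW : cintegrable P (fun t => cexp (- (s * (V n t * W n t)%:C))).
  by apply: (bounded_cintegrable (C := 1)) => //; exact: cmeasurable_laplace.
have [i1 e1] := cintegral_independent mV mW (indep_WV n) mh1 iVW.
have LE t : E (fun t' => cexp (- (s * (V n t * W n t')%:C))) =
    LST P (W n) (s * (V n t)%:C).
  by apply: eq_cintegral => t'; rewrite rmorphM/= mulrA.
have mh2 : cmeasurable (fun z : R * R => cexp (- (s * z.1%:C)) * cexp (- (- s * z.2%:C))).
  by apply: cmeasurableM; exact: cmeasurable_laplace.
have XE t : cexp (- (s * (X n t)%:C)) =
    cexp (- (s * (V n t * W n t)%:C)) * cexp (- (- s * (A n t)%:C)).
  by rewrite -cexpD; congr cexp; rewrite rmorphB/=; ring.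
have iX : cintegrable P (fun t => cexp (- (s * (X n t)%:C))).
  apply: (bounded_cintegrable (C := 1)); first exact: cmeasurable_laplace.
  apply: filterS (X_le0 n) => t Xt; apply: normc_cexp_le1.
  by rewrite Re_Nmul oppr_le0 mulr_le0.
have iX' : cintegrable P (fun t =>
    cexp (- (s * (V n t * W n t)%:C)) * cexp (- (- s * (A n t)%:C))).
  by under [F in cintegrable P F]eq_fun do rewrite -XE.
have [_ e2] := cintegral_independent (measurable_VW n) mA (indep_VWA n) mh2 iX'.
split => //; split.
  by under [F in cintegrable P F]eq_fun do rewrite -LE.
rewrite (eq_cintegral _ XE) e2.
have iA : cintegrable P (fun t => cexp (- (- s * (A n t)%:C))).
  apply: (bounded_cintegrable (C := 1)); first exact: cmeasurable_laplace.
  apply: filterS (hAn n) => t At; apply: normc_cexp_le1.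
  by rewrite Re_Nmul oppr_le0 mulr_ge0// ReN oppr_ge0.
have -> : E (fun t => E (fun t' => cexp (- (s * (V n t * W n t)%:C)) *
    cexp (- (- s * (A n t')%:C)))) =
    E (fun t => LST P (A 0%N) (- s) * cexp (- (s * (V n t * W n t)%:C))).
  by apply: eq_cintegral => t; rewrite cintegralZl// mulrC -(LST_An n).
have e3 : E (fun t => cexp (- (s * (V n t * W n t)%:C))) =
    E (fun t => LST P (W n) (s * (V n t)%:C)).
  by apply: etrans e1 _; apply: eq_cintegral => t; exact: LE.
by rewrite -e3; exact: cintegralZl.
Qed.

(** Only finitely many values enter [interp], and linearly, so integrability at the nodes is enough
    for the exchange, whatever s is. *)
Lemma cintegral_interp (F : T -> R[i] -> R[i]) s :
  (forall i : 'I_l.+1, cintegrable P (fun t => F t i%:R)) ->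
  cintegrable P (fun t => (interp l (fun z => D.[z] * F t z)).[s]) /\
  E (fun t => (interp l (fun z => D.[z] * F t z)).[s]) =
  (interp l (fun z => D.[z] * E (fun t => F t z))).[s].
Proof.
move=> iF.
have i1 (i : 'I_l.+1) : cintegrable P (fun t => ((lag R i).[s] * D.[i%:R]) * F t i%:R).
  exact: cintegrableZl.
have e1 t : (interp l (fun z => D.[z] * F t z)).[s] =
    \sum_(i < l.+1) ((lag R i).[s] * D.[i%:R]) * F t i%:R.
  rewrite horner_sum; apply: eq_bigr => i _; rewrite hornerZ; ring.
split; first by under [G in cintegrable P G]eq_fun do rewrite e1; exact: cintegrable_sum.
rewrite (eq_cintegral _ e1) cintegral_sum// horner_sum; apply: eq_bigr => i _.
by rewrite cintegralZl// hornerZ; ring.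
Qed.

Lemma Re_nat_ge0 i : 0 <= complex.Re (i%:R : R[i]).
Proof. by rewrite -(rmorph_nat (real_complex R))/=. Qed.

Let step_interp n s : 
  cintegrable P (fun t => (interp l (fun z => D.[z] * over P (B n) (X n t) z)).[s]) /\
  E (fun t => (interp l (fun z => D.[z] * over P (B n) (X n t) z)).[s]) =
  (interp l (fun z => D.[z] * LST P (W n.+1) z)).[s].
Proof.
have [|i e] := @cintegral_interp (fun t z => over P (B n) (X n t) z) s.
  by move=> i; have [] := LST_WS n (Re_nat_ge0 i).
split=> //; rewrite e; congr (_.[s]); apply: eq_bigr => j _; congr (_ * _ *: _).
by have [_ ->] := LST_WS n (Re_nat_ge0 j).
Qed.

Lemma step_over n s : 0 <= complex.Re s ->
  D.[s] * LST P (W n.+1) s = (interp l (fun z => D.[z] * LST P (W n.+1) z)).[s].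
Proof.
move=> s0; have [i1 e1] := step_interp n s; have [i2 ->] := LST_WS n s0.
rewrite -e1 -cintegralZl//; apply: ae_eq_cintegral.
- exact: (cintegrable_measurable (cintegrableZl D.[s] i2)).
- exact: cintegrable_measurable i1.
- apply: filterS (X_le0 n) => t Xt.
  rewrite (over_under (measurable_RV (B n)) (hBn n) hs (LST_Bn n) Xt s0).
  exact: (under_interp (measurable_RV (B n)) (hBn n) hs hN (LST_Bn n)).
Qed.

(** [under_interp] averaged over x = V n W n - A n. The polynomial on the right is the one of
    [step_over], which ties Wstar n to W n.+1 across the imaginary axis. *)
Lemma step_under n s : complex.Re s <= 0 ->
  D.[s] * (1 - LST P (Wstar n) s) +
    N.[s] * (LST P (A 0%N) (- s) * E (fun t => LST P (W n) (s * (V n t)%:C))) =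
  (interp l (fun z => D.[z] * LST P (W n.+1) z)).[s].
Proof.
move=> s0; have [i1 e1] := step_interp n s; have [i2 e2] := LST_WstarE n s0.
have [i3 [_ e3]] := LST_X n s0.
have i4 : cintegrable P (fun t => D.[s] + - D.[s] * under P (B n) (X n t) s).
  by apply: cintegrableD; [exact: cintegrable_cst|exact: cintegrableZl].
have i5 : cintegrable P (fun t => N.[s] * cexp (- (s * (X n t)%:C))).
  exact: cintegrableZl.
rewrite -e1 -e3 e2.
have -> : D.[s] * (1 - E (fun t => under P (B n) (X n t) s)) =
    E (fun t => D.[s] + - D.[s] * under P (B n) (X n t) s).
  rewrite cintegralD; [|exact: cintegrable_cst|exact: cintegrableZl].
  by rewrite cintegral_cst cintegralZl//; ring.
rewrite -cintegralZl// -cintegralD//; apply: ae_eq_cintegral.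
- exact: (cintegrable_measurable (cintegrableD i4 i5)).
- exact: cintegrable_measurable i1.
- apply: filterS (X_le0 n) => t Xt.
  rewrite -(under_interp (measurable_RV (B n)) (hBn n) hs hN (LST_Bn n) s Xt).
  by congr (_ + _); ring.
Qed.

End OneStep.

(** * The transforms of W and Wstar *)

Section Generating.
Context d (T : measurableType d) (R : realType) (P : probability T R).
Local Notation E := (cintegral P setT).
Variables (V A B : nat -> {RV P >-> R}) (l : nat) (N : {poly R[i]}) (s_ : 'I_l -> R[i]).
Hypothesis hindep : mutually_independent (inputs V A B).
Hypothesis hidV : identically_distributed V.
Hypothesis hidA : identically_distributed A.
Hypothesis hidB : identically_distributed B.
Hypothesis hA : {ae P, forall t, 0 <= A 0%N t}.
Hypothesis hB : {ae P, forall t, 0 <= B 0%N t}.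
Hypothesis hV : {ae P, forall t, V 0%N t < 0}.
Hypothesis hs : forall j, complex.Re (s_ j) < 0.
Hypothesis hN : (size N <= l)%N.
Hypothesis hBrat : forall s : R[i], 0 <= complex.Re s ->
  LST P (B 0%N) s = N.[s] / (DB s_).[s].
Variable r : R.
Hypothesis hr : 0 < r < 1.
Variable w : R.
Hypothesis hw : 0 <= w.

Local Notation D := (DB s_).
Local Notation W := (W w V A B).
Local Notation Wstar := (Wstar w V A B).
Local Notation UW := (U P W r).
Local Notation IV := (cintegral (distribution P (V 0%N)) `]-oo, 0]).

Let r0 : 0 < r. Proof. by case/andP: hr. Qed.
Let r1 : r < 1. Proof. by case/andP: hr. Qed.
Let rC0 : r%:C != 0.
Proof. by rewrite -normc_gt0 normcR gtr0_norm. Qed.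
Let normc_1r : normc (1 - r%:C) = 1 - r.
Proof.
have -> : 1 - r%:C = (1 - r)%:C by rewrite rmorphB rmorph1.
by rewrite normcR gtr0_norm ?subr_gt0.
Qed.
Let r1C0 : 1 - r%:C != 0.
Proof. by rewrite -normc_gt0 normc_1r subr_gt0. Qed.

Lemma LST_W0 s : LST P (W 0) s = cexp (- (s * w%:C)).
Proof. exact: (cintegral_cst P (cexp (- (s * w%:C)))). Qed.

Lemma Re_neg_mul (s : R[i]) (y : R) : complex.Re s <= 0 -> y <= 0 ->
  0 <= complex.Re (s * y%:C).
Proof. by move=> s0 y0; rewrite ReMr mulr_le0. Qed.

Lemma cmeasurable_scale (s : R[i]) : cmeasurable (fun y : R => s * y%:C).
Proof.
by apply: cmeasurableM; [exact: cmeasurable_cst|exact: (@cmeasurable_real _ _ _ id)].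
Qed.

(** Measurability in y is read off from closed forms: an exponential for n = 0 and, by [step_over],
    a rational function afterwards. *)
Lemma LST_W_negative n s : complex.Re s <= 0 -> exists2 G : R -> R[i],
  cmeasurable G & forall y, y <= 0 -> LST P (W n) (s * y%:C) = G y.
Proof.
move=> s0; case: n => [|n].
  exists (fun y => cexp (- ((s * y%:C) * w%:C))); last by move=> y _; exact: LST_W0.
  apply: cmeasurable_cexp; apply: cmeasurableN.
  by apply: cmeasurableM; [exact: cmeasurable_scale|exact: cmeasurable_cst].
exists (fun y => (interp l (fun z => D.[z] * LST P (W n.+1) z)).[s * y%:C] / D.[s * y%:C]).
  apply: cmeasurableM; last apply: cmeasurableV;
    by apply: cmeasurable_horner; exact: cmeasurable_scale.
move=> y y0; have sy := Re_neg_mul s0 y0.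
rewrite -(step_over hindep hidV hidA hidB hA hB hV hs hN hBrat hw n sy).
by rewrite mulrAC divff ?mul1r//; exact: DB_neq0.
Qed.

Lemma negative_bound (G : R -> R[i]) (C : R) : cmeasurable G ->
  (forall y, y <= 0 -> normc (G y) <= C) ->
  cintegrable P (fun t => G (V 0%N t)) /\ normc (E (fun t => G (V 0%N t))) <= 2 * C.
Proof.
move=> mG GC; apply: cintegrable_bounded.
  by apply: cmeasurable_comp => //; exact: measurable_RV.
by apply: filterS hV => t Vt; apply: GC; exact: ltW.
Qed.

Lemma step_under_distribution n s : complex.Re s <= 0 ->
  D.[s] * (1 - LST P (Wstar n) s) +
    N.[s] * LST P (A 0%N) (- s) * IV (fun y => LST P (W n) (s * y%:C)) =
  (interp l (fun z => D.[z] * LST P (W n.+1) z)).[s].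
Proof.
move=> s0.
rewrite -(step_under hindep hidV hidA hidB hA hB hV hs hN hBrat hw n s0).
rewrite -mulrA; congr (_ + _ * (_ * _)).
have [G mG GE] := LST_W_negative n s0.
have G2 y : y <= 0 -> normc (G y) <= 2.
  by move=> y0; rewrite -GE// bounded_LST_W//; exact: Re_neg_mul.
have [iG _] := negative_bound mG G2.
rewrite (cintegral_negative hV mG iG GE).
have iGn : cintegrable P (fun t => G (V n t)).
  apply: (bounded_cintegrable (C := 2)).
    by apply: cmeasurable_comp => //; exact: measurable_RV.
  by apply: filterS (ae_V_lt0 hidV hV n) => t Vt; apply: G2; exact: ltW.
rewrite -(cintegral_identically_distributed hidV mG iGn iG).
have [_ [iL _]] := LST_X hindep hidV hidA hA hV hw n s0.
apply: ae_eq_cintegral.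
- by apply: cmeasurable_comp => //; exact: measurable_RV.
- exact: cintegrable_measurable iL.
- by apply: filterS (ae_V_lt0 hidV hV n) => t Vt; rewrite GE// ltW.
Qed.

Lemma cvgC_UW s : 0 <= complex.Re s ->
  cvgC (fun n => \sum_(i < n) r%:C ^+ i * LST P (W i) s) (UW s).
Proof.
by move=> s0; apply: (cvgC_U hr (C := 2)) => i; exact: bounded_LST_W.
Qed.

Lemma cvgC_UWS s : 0 <= complex.Re s ->
  cvgC (fun n => \sum_(i < n) r%:C ^+ i.+1 * LST P (W i.+1) s)
    (UW s - cexp (- (s * w%:C))).
Proof.
move=> s0; have := cvgCD (cvgCS (cvgC_UW s0)) (cvgC_cst (- cexp (- (s * w%:C)))).
congr cvgC; apply/funext => n.
by rewrite big_ord_recl expr0 mul1r LST_W0 addrAC subrr add0r.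
Qed.

(** The numerator in the formula for U of W. Subtracting e^{-zw} removes the term i = 0, which no
    recursion step produces. *)
Definition UWpoly := interp l (fun z => D.[z] * (UW z - cexp (- (z * w%:C)))).

Lemma interp_sum m (c : nat -> R[i]) (F : nat -> R[i] -> R[i]) s :
  \sum_(i < m) c i * (interp l (fun z => D.[z] * F i z)).[s] =
  (interp l (fun z => D.[z] * (\sum_(i < m) c i * F i z))).[s].
Proof.
rewrite horner_sum.
under eq_bigr do rewrite horner_sum mulr_sumr.
rewrite exchange_big/=; apply: eq_bigr => j _.
rewrite hornerZ mulr_sumr mulr_suml; apply: eq_bigr => i _.
by rewrite hornerZ; ring.
Qed.

Lemma cvgC_UWpoly s :
  cvgC (fun m => \sum_(i < m) r%:C ^+ i.+1 *
    (interp l (fun z => D.[z] * LST P (W i.+1) z)).[s]) UWpoly.[s].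
Proof.
under [X in cvgC X]eq_fun do
  rewrite (interp_sum _ (fun i => r%:C ^+ i.+1) (fun i => LST P (W i.+1))).
apply: cvgC_horner_interp => i; apply: cvgCZ; apply: cvgC_UWS.
exact: Re_nat_ge0.
Qed.

Lemma UW_equation s : 0 <= complex.Re s ->
  D.[s] * (UW s - cexp (- (s * w%:C))) = UWpoly.[s].
Proof.
move=> s0; apply: cvgC_unique (cvgC_UWpoly s).
have := cvgCZ D.[s] (cvgC_UWS s0); congr cvgC; apply/funext => n.
rewrite mulr_sumr; apply: eq_bigr => i _.
by rewrite -(step_over hindep hidV hidA hidB hA hB hV hs hN hBrat hw i s0) mulrCA.
Qed.

Lemma UW_E s : 0 <= complex.Re s -> UW s = cexp (- (s * w%:C)) + UWpoly.[s] / D.[s].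
Proof.
move=> s0; rewrite -(UW_equation s0) mulrAC divff; last exact: DB_neq0.
by rewrite mul1r [RHS]addrC subrK.
Qed.

(** Right-hand side of [UW_E] at s y: for Re s <= 0 and y <= 0 it is U of W there, and unlike the
    series it is clearly measurable in y on the whole line. *)
Definition UWneg s (y : R) : R[i] :=
  cexp (- ((s * y%:C) * w%:C)) + UWpoly.[s * y%:C] / D.[s * y%:C].

Lemma cmeasurable_UWneg s : cmeasurable (UWneg s).
Proof.
apply: cmeasurableD.
  apply: cmeasurable_cexp; apply: cmeasurableN.
  by apply: cmeasurableM; [exact: cmeasurable_scale|exact: cmeasurable_cst].
apply: cmeasurableM; last apply: cmeasurableV;
  by apply: cmeasurable_horner; exact: cmeasurable_scale.
Qed.

Lemma normc_UW s : 0 <= complex.Re s -> normc (UW s) <= 4 / (1 - r).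
Proof.
move=> s0; have := U_rate hr (P := P) (X := W) (s := s) (C := 2)
  (fun i => bounded_LST_W V A B hw i s0) 0.
rewrite big_ord0 sub0r normcN expr0 mulr1.
by congr (_ <= _ / _); rewrite -natrM.
Qed.

Lemma IV_UW s : complex.Re s <= 0 ->
  cintegrable P (fun t => UWneg s (V 0%N t)) /\
  IV (fun y => UW (s * y%:C)) = E (fun t => UWneg s (V 0%N t)).
Proof.
move=> s0.
have e y : y <= 0 -> UW (s * y%:C) = UWneg s y.
  by move=> y0; exact: UW_E (Re_neg_mul s0 y0).
have [|iU _] := @negative_bound (UWneg s) (4 / (1 - r)) (cmeasurable_UWneg s).
  by move=> y y0; rewrite -e//; exact: normc_UW (Re_neg_mul s0 y0).
by split=> //; rewrite (cintegral_negative hV (cmeasurable_UWneg s) iU e).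
Qed.

Lemma cvgC_IV_UW s : complex.Re s <= 0 ->
  cvgC (fun n => \sum_(i < n) r%:C ^+ i * IV (fun y => LST P (W i) (s * y%:C)))
    (IV (fun y => UW (s * y%:C))).
Proof.
move=> s0; have [iU ->] := IV_UW s0.
have /choice[G hG] i : exists G : R -> R[i], cmeasurable G /\
    forall y, y <= 0 -> LST P (W i) (s * y%:C) = G y.
  by have [G mG GE] := LST_W_negative i s0; exists G.
have iG i : cintegrable P (fun t => G i (V 0%N t)).
  have [mG GE] := hG i; have [|//] := @negative_bound (G i) 2 mG.
  by move=> y y0; rewrite -GE// bounded_LST_W//; exact: Re_neg_mul.
(* 4/(1 - r) is the rate of [U_rate] for transforms bounded by 2, uniform in y <= 0; the outer 2 is
   that of complex integration. *)
apply: (cvgC_geo hr (K := 2 * (4 / (1 - r)))) => n.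
have -> : \sum_(i < n) r%:C ^+ i * IV (fun y => LST P (W i) (s * y%:C)) -
    E (fun t => UWneg s (V 0%N t)) =
    E (fun t => \sum_(i < n) r%:C ^+ i * G i (V 0%N t) + -1 * UWneg s (V 0%N t)).
  have iZ (i : 'I_n) := cintegrableZl (r%:C ^+ i) (iG i).
  have iS := cintegrable_sum (index_enum 'I_n) iZ.
  rewrite (cintegralD iS (cintegrableZl (-1) iU)) (cintegralZl _ iU) mulN1r.
  rewrite (cintegral_sum _ iZ); congr (_ - _); apply: eq_bigr => i _.
  rewrite (cintegralZl _ (iG i)); congr (_ * _).
  by have [mG GE] := hG i; exact: cintegral_negative.
rewrite -mulrA; apply: (negative_bound
  (G := fun y => \sum_(i < n) r%:C ^+ i * G i y + -1 * UWneg s y) _ _).2.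
  apply: cmeasurableD; last first.
    by apply: cmeasurableM; [exact: cmeasurable_cst|exact: cmeasurable_UWneg].
  apply: cmeasurable_sum => i; apply: cmeasurableM; first exact: cmeasurable_cst.
  by case: (hG i).
move=> y y0; have sy := Re_neg_mul s0 y0.
have := U_rate hr (P := P) (X := W) (s := s * y%:C) (C := 2)
  (fun i => bounded_LST_W V A B hw i sy) n.
rewrite (UW_E sy) mulN1r (_ : 2 * 2 = 4); last by rewrite -natrM.
congr (normc (_ - _) <= _); apply: eq_bigr => i _; congr (_ * _).
by have [_ ->] := hG i.
Qed.

Lemma cvgC_UWstar s : complex.Re s <= 0 ->
  cvgC (fun n => \sum_(i < n) r%:C ^+ i * LST P (Wstar i) s) (U P Wstar r s).
Proof.
by move=> s0; apply: (cvgC_U hr (C := 2)) => i; exact: bounded_LST_Wstar.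
Qed.

Lemma cvgC_geometric : cvgC (fun n => \sum_(i < n) r%:C ^+ i) (1 - r%:C)^-1.
Proof.
apply: (cvgC_geo hr (K := (1 - r)^-1)) => n.
have -> : \sum_(i < n) r%:C ^+ i - (1 - r%:C)^-1 = - (r%:C ^+ n / (1 - r%:C)).
  have := subrX1 r%:C n; move: (\sum_(i < n) _) (r%:C ^+ n) => S rn h.
  have -> : rn = 1 + (r%:C - 1) * S by rewrite -h; ring.
  by field.
rewrite normcN normcM normcX normcR (gtr0_norm r0) mulrC normcV.
by rewrite normc_1r.
Qed.

(** Left multiplied by D so that it remains valid at the zeros s_j, where it turns into the linear
    system. The factor 1/r appears because Wstar i, weighted by r^i, is paired with W i.+1, weighted
    by r^(i+1). *)
Lemma UWstar_equation s : complex.Re s <= 0 ->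
  D.[s] * ((1 - r%:C)^-1 - U P Wstar r s) +
    N.[s] * LST P (A 0%N) (- s) * IV (fun y => UW (s * y%:C)) =
  r%:C^-1 * UWpoly.[s].
Proof.
move=> s0; apply: cvgC_unique (cvgCZ r%:C^-1 (cvgC_UWpoly s)).
have h1 := cvgCZ D.[s] (cvgCD cvgC_geometric (cvgCZ (-1) (cvgC_UWstar s0))).
have h2 := cvgCZ (N.[s] * LST P (A 0%N) (- s)) (cvgC_IV_UW s0).
rewrite mulN1r in h1; have := cvgCD h1 h2; congr cvgC; apply/funext => n.
rewrite mulN1r -sumrB !mulr_sumr -big_split/=; apply: eq_bigr => i _.
by rewrite -step_under_distribution// exprS; field.
Qed.

Definition Ucoef (k : 'I_l.+1) : R[i] := UWpoly`_k.

Lemma Ucoef_sum s : \sum_(k < l.+1) Ucoef k * s ^+ k = UWpoly.[s].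
Proof. by rewrite (horner_coef_wide _ (size_interp _ _)). Qed.

(** At s = 0 every transform equals 1, so U of W is 1/(1 - r) and the constant term is D(0) (1/(1 -
    r) - 1). *)
Lemma Ucoef0 : Ucoef ord0 = r%:C / (1 - r%:C) * (-1) ^+ l * \prod_(j < l) s_ j.
Proof.
rewrite /Ucoef /= -horner_coef0 -UW_equation//.
have -> : UW 0 = (1 - r%:C)^-1.
  apply: cvgC_unique cvgC_geometric; have := cvgC_UW (s := 0) (lexx 0).
  congr cvgC; apply/funext => n; apply: eq_bigr => i _.
  rewrite (_ : LST _ _ _ = 1) ?mulr1// /LST -[RHS](cintegral_cst P).
  by apply: eq_cintegral => t; rewrite mul0r oppr0 cexp0.
rewrite mul0r oppr0 cexp0 /DB horner_prod.
have -> : \prod_(j < l) ('X - (s_ j)%:P).[0] = (-1) ^+ l * \prod_(j < l) s_ j.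
  under eq_bigr do rewrite hornerXsubC sub0r -mulN1r.
  by rewrite big_split/= prodr_const card_ord.
by field.
Qed.

End Generating.

(** * The linear system *)

Section ExponentialSums.
Variable R : realType.
Implicit Types (x : R[i]) (al : R).

(* Riemann sums of [\int_0^oo e^{-x v} dv = 1 / x]. *)
Definition expsum n x : R[i] := n.+1%:R^-1 *
  \sum_(k < (n.+1 ^ 2)%N) cexp (- (x * (k%:R / n.+1%:R)%:C)).

Let expsumE n x : expsum n x = n.+1%:R^-1 *
  \sum_(k < (n.+1 ^ 2)%N) cexp (- (x / n.+1%:R)) ^+ k.
Proof.
congr (_ * _); apply: eq_bigr => k _; rewrite -cexpMn; congr cexp.
rewrite -mulr_natr rmorphM/= fmorphV/= !rmorph_nat; ring.
Qed.

Let expR_opp_le (c : R) : 0 < c -> expR (- c) <= c^-1.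
Proof.
move=> c0; rewrite expRN lef_pV2 ?posrE ?expR_gt0//.
by rewrite (le_trans _ (expR_ge1Dx c))// lerDr.
Qed.

Let normc_nV n : normc (n.+1%:R^-1 : R[i]) = n.+1%:R^-1.
Proof. by rewrite normcV normc_nat. Qed.

Let Re_div_nat x n : complex.Re (x / n.+1%:R) = complex.Re x / n.+1%:R.
Proof.
rewrite (_ : x / n.+1%:R = x * (n.+1%:R^-1)%:C) ?ReMr//.
by rewrite fmorphV/= rmorph_nat.
Qed.

(** Termwise domination by a geometric sum of ratio rho = e^{-al h}, h being the mesh. As rho (1 +
    al h) <= 1, one has al h <= (1 - rho)(1 + al h), hence h/(1 - rho) <= (1 + al h)/al. The bound
    is free of n, as dominated convergence demands. *)
Lemma expsum_bound n x al : 0 < al -> al <= complex.Re x ->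
  normc (expsum n x) <= (1 + al) / al.
Proof.
move=> al0 xal; rewrite expsumE normcM normc_nV.
set h := n.+1%:R^-1; have h0 : 0 < h by rewrite invr_gt0.
have h1 : h <= 1 by rewrite invf_le1// ler1n.
set q := cexp _; pose rho := expR (- (al * h)).
have qr : normc q <= rho.
  rewrite normc_cexp ler_expR ReN lerN2 Re_div_nat ler_wpM2r//.
  exact: ltW.
set K := (n.+1 ^ 2)%N; set S := \sum_(k < K) rho ^+ k.
have qS : normc (\sum_(k < K) q ^+ k) <= S.
  rewrite (le_trans (ler_normc_sum _ _ _))//; apply: ler_sum => k _.
  by rewrite normcX lerXn2r ?nnegrE ?normc_ge0 ?expR_ge0.
have S0 : 0 <= S by apply: sumr_ge0 => k _; rewrite exprn_ge0 ?expR_ge0.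
have SE := subrX1 rho K; rewrite -/S in SE.
have rK : 0 <= rho ^+ K by rewrite exprn_ge0 ?expR_ge0.
have rr : rho * (1 + al * h) <= 1.
  have := expRxMexpNx_1 (al * h); rewrite mulrC -/rho => e.
  by rewrite -[leRHS]e ler_wpM2l ?expR_ge0 ?expR_ge1Dx.
rewrite ler_pdivlMr//.
have ah : 0 <= al * h by rewrite mulr_ge0// ltW.
have e1 : h * S * al <= (1 - rho) * (1 + al * h) * S.
  have -> : h * S * al = al * h * S by ring.
  by rewrite ler_wpM2r//; lra.
have e2 : (1 - rho) * (1 + al * h) * S <= 1 + al * h.
  have -> : (1 - rho) * (1 + al * h) * S = (1 + al * h) * (1 - rho ^+ K).
    have -> : rho ^+ K = 1 + (rho - 1) * S by rewrite -SE addrC subrK.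
    by ring.
  by rewrite ler_piMr ?addr_ge0//; lra.
rewrite (le_trans (y := h * S * al))//.
  by rewrite ler_wpM2r ?(ltW al0)// ler_wpM2l// ltW.
have e3 : al * h <= al by rewrite ler_piMr// ltW.
lra.
Qed.

(** The error is explicit (identity [E] below): q^((n+1)^2) = e^{-x(n+1)} is the tail cut off at n +
    1, and del = q - 1 + x/(n+1) is of second order in the mesh, so that n + 1 times del still tends
    to 0. *)
Lemma expsum_cvg x : 0 < complex.Re x -> cvgC (fun n => expsum n x) x^-1.
Proof.
move=> x0; set al := complex.Re x.
have x_neq0 : x != 0 by apply: contraTneq x0 => ->; rewrite ltxx.
pose C := (al^-1 + (1 + al) / al * (4 * normc x ^+ 2)) / normc x.
have c0 : (C * n.+1%:R^-1) @[n --> \oo] --> (0 : R).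
  by rewrite -(mulr0 C); apply: cvgMl_tmp; exact: cvg_harmonic.
apply: (squeeze_cvgr _ (cvg_cst 0) c0); near=> n; rewrite normc_ge0/=.
set h := n.+1%:R^-1; have h0 : 0 < h by rewrite invr_gt0.
have nx : 2 * normc x <= n.+1%:R.
  rewrite (le_trans (y := n%:R)) ?ler_nat//.
  by near: n; exact: nbhs_infty_ger.
have xh : normc (- (x / n.+1%:R)) = normc x * h.
  by rewrite normcN normcM normc_nV.
have xh2 : normc (- (x / n.+1%:R)) <= 2^-1.
  by rewrite xh /h ler_pdivrMr//; lra.
have := normc_cexpB1x xh2; rewrite xh.
have gb := expsum_bound n x0 (lexx _); rewrite -/al in gb.
set del := cexp _ - 1 - _ => dh.
set q := cexp (- (x / n.+1%:R)) in del dh.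
have qK : normc (q ^+ (n.+1 ^ 2)) <= al^-1 * h.
  rewrite -cexpMn normc_cexp.
  have -> : - (x / n.+1%:R) *+ (n.+1 ^ 2)%N = - (x * n.+1%:R).
    by rewrite -[_ *+ (_ ^ _)]mulr_natr natrX; field.
  rewrite ReN -(rmorph_nat (real_complex R)) ReMr -invfM.
  by apply: expR_opp_le; rewrite mulr_gt0.
have E : expsum n x * x - 1 = - q ^+ (n.+1 ^ 2) + expsum n x * del * n.+1%:R.
  have g1 : expsum n x * (1 - q) = n.+1%:R^-1 * (1 - q ^+ (n.+1 ^ 2)).
    rewrite expsumE -/q -mulrA; congr (_ * _).
    have := subrX1 q (n.+1 ^ 2)%N => e.
    by rewrite -[RHS]opprB e; ring.
  have -> : q ^+ (n.+1 ^ 2) = 1 - n.+1%:R * (expsum n x * (1 - q)).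
    by rewrite g1; field.
  by rewrite /del; field.
have -> : expsum n x - x^-1 = (expsum n x * x - 1) / x by field.
rewrite normcM normcV E /C [leRHS]mulrAC ler_wpM2r ?invr_ge0 ?normc_ge0//.
rewrite (le_trans (ler_normcD _ _))// normcN mulrDl lerD//.
rewrite 2!normcM normc_nat.
have -> : (1 + al) / al * (4 * normc x ^+ 2) * h =
    (1 + al) / al * (4 * (normc x * h) ^+ 2) * n.+1%:R.
  by rewrite /h; field; rewrite nat1r pnatr_eq0/= gt_eqF.
rewrite ler_wpM2r// ler_pM ?normc_ge0//.
Unshelve. all: by end_near. Qed.

Lemma cexp_scale_cvg0 x : 0 < complex.Re x ->
  cvgC (fun n => cexp (- (x * n.+1%:R%:C))) 0.
Proof.
move=> x0; apply: (@cvgC_le _ _ _ (fun n => (complex.Re x)^-1 * n.+1%:R^-1)).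
  move=> n; rewrite subr0 normc_cexp ReN ReMr -invfM.
  by apply: expR_opp_le; rewrite mulr_gt0.
by rewrite -(mulr0 (complex.Re x)^-1); apply: cvgMl_tmp; exact: cvg_harmonic.
Qed.

End ExponentialSums.

(** * The system as a condition on polynomials, and uniqueness of its solution *)

Section LinearSystem.
Context d (T : measurableType d) (R : realType) (P : probability T R).
Local Notation E := (cintegral P setT).
Variables (V A : {RV P >-> R}) (l : nat) (N : {poly R[i]}) (s_ : 'I_l -> R[i]).
Hypothesis hV : {ae P, forall t, V t < 0}.
Hypothesis hs : forall j, complex.Re (s_ j) < 0.
Variable r : R.

Local Notation D := (DB s_).
Local Notation IV := (cintegral (distribution P V) `]-oo, 0]).

Definition sysweight (j : 'I_l) : R[i] := r%:C * N.[s_ j] * LST P A (- s_ j).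

Lemma horner_DB z : D.[z] = \prod_(m < l) (z - s_ m).
Proof. by rewrite /DB horner_prod; apply: eq_bigr => m _; rewrite hornerXsubC. Qed.

Lemma root_DB j : D.[s_ j] = 0.
Proof. by rewrite horner_DB (bigD1 j)//= subrr mul0r. Qed.

Lemma Re_negative_pos (j : 'I_l) (y : R) : y <= 0 -> 0 <= complex.Re (s_ j * y%:C).
Proof. by move=> y0; rewrite ReMr mulr_le0// ltW. Qed.

(** For y <= 0 the real part of s_j y - s_m is |Re s_j| |y| + |Re s_m|, at least c_m (1 + |y|); the
    product over m dominates |y|^k as k <= l. *)
Lemma ratio_bound (j : 'I_l) : exists C : R, forall (k : nat) (y : R),
  (k <= l)%N -> y <= 0 -> normc (y%:C ^+ k / D.[s_ j * y%:C]) <= C.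
Proof.
pose c m := Num.min (- complex.Re (s_ j)) (- complex.Re (s_ m)).
have c0 m : 0 < c m by rewrite lt_min !oppr_gt0 !hs.
have pc0 : 0 < \prod_(m < l) c m by apply: prodr_gt0.
exists (\prod_(m < l) c m)^-1 => k y kl y0.
have y1 : 1 <= 1 + `|y| by rewrite lerDl.
have y10 : 0 < 1 + `|y| by rewrite (lt_le_trans _ y1).
have Dlow : \prod_(m < l) c m * (1 + `|y|) ^+ l <= normc D.[s_ j * y%:C].
  rewrite horner_DB normc_prod.
  rewrite -[l in _ ^+ l]card_ord -prodr_const -big_split/=; apply: ler_prod => m _.
  rewrite mulr_ge0 ?(ltW (c0 m)) ?(ltW y10)//=.
  rewrite (le_trans _ (normc_ge_Re _))// (le_trans _ (ler_norm _))//.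
  rewrite ReD ReN ReMr (ler0_norm y0) mulrDr mulr1 addrC.
  have cj : c m <= - complex.Re (s_ j) by rewrite ge_min lexx.
  have cm : c m <= - complex.Re (s_ m) by rewrite ge_min lexx orbT.
  by apply: lerD => //; rewrite -[leRHS]mulrNN ler_wpM2r// oppr_ge0.
have D0 : 0 < normc D.[s_ j * y%:C].
  by rewrite (lt_le_trans _ Dlow)// mulr_gt0// exprn_gt0.
rewrite normcM normcV normcX normcR ler_pdivrMr// ler_pdivlMl//.
apply: le_trans Dlow; rewrite ler_wpM2l ?(ltW pc0)//.
rewrite (le_trans (y := (1 + `|y|) ^+ k))//.
  by rewrite lerXn2r ?nnegrE ?(ltW y10)// lerDr.
by rewrite ler_weXn2l.
Qed.

Lemma cmeasurable_ratio j (k : nat) :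
  cmeasurable (fun y : R => y%:C ^+ k / D.[s_ j * y%:C]).
Proof.
apply: cmeasurableM.
  by apply: cmeasurableX; exact: (@cmeasurable_real _ _ _ id).
by apply: cmeasurableV; apply: cmeasurable_horner; exact: cmeasurable_scale.
Qed.

Lemma bounded_negative (G : R -> R[i]) (C : R) : cmeasurable G ->
  (forall y, y <= 0 -> normc (G y) <= C) -> cintegrable P (fun t => G (V t)).
Proof.
move=> mG GC; apply: (bounded_cintegrable (C := C)).
  by apply: cmeasurable_comp => //; exact: measurable_RV.
by apply: filterS hV => t Vt; apply: GC; exact: ltW.
Qed.

Lemma cintegrable_ratio j (k : nat) : (k <= l)%N ->
  cintegrable P (fun t => (V t)%:C ^+ k / D.[s_ j * (V t)%:C]).
Proof.
move=> kl; have [C hC] := ratio_bound j.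
apply: (bounded_negative (C := C) (cmeasurable_ratio j k)) => y y0.
exact: hC.
Qed.

Lemma IV_ratio j (k : nat) : (k <= l)%N ->
  IV (fun y => y%:C ^+ k / \prod_(m < l) (s_ j * y%:C - s_ m)) =
  E (fun t => (V t)%:C ^+ k / D.[s_ j * (V t)%:C]).
Proof.
move=> kl; apply: (@cintegral_negative _ _ _ _ _ _
  (fun y => y%:C ^+ k / D.[s_ j * y%:C])) => //.
- exact: cmeasurable_ratio.
- exact: cintegrable_ratio.
- by move=> y _; rewrite horner_DB.
Qed.

Lemma cintegrable_exp j (v : R) : 0 <= v ->
  cintegrable P (fun t => cexp (- (s_ j * (V t)%:C * v%:C))).
Proof.
move=> v0; apply: (@bounded_negative (fun y => cexp (- (s_ j * y%:C * v%:C))) 1).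
  apply: cmeasurable_cexp; apply: cmeasurableN.
  by apply: cmeasurableM; [exact: cmeasurable_scale|exact: cmeasurable_cst].
move=> y y0; apply: normc_cexp_le1.
by rewrite Re_Nmul oppr_le0 mulr_ge0// Re_negative_pos.
Qed.

Lemma IV_exp j (v : R) : 0 <= v ->
  IV (fun y => cexp (- (s_ j * v%:C * y%:C))) =
  E (fun t => cexp (- (s_ j * (V t)%:C * v%:C))).
Proof.
move=> v0; apply: (@cintegral_negative _ _ _ _ _ _
  (fun y => cexp (- (s_ j * y%:C * v%:C)))) => //.
- apply: cmeasurable_cexp; apply: cmeasurableN.
  by apply: cmeasurableM; [exact: cmeasurable_scale|exact: cmeasurable_cst].
- exact: cintegrable_exp.
- by move=> y _; rewrite mulrAC.
Qed.

Lemma cintegral_poly_ratio (q : {poly R[i]}) j : (size q <= l.+1)%N ->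
  cintegrable P (fun t => q.[s_ j * (V t)%:C] / D.[s_ j * (V t)%:C]) /\
  E (fun t => q.[s_ j * (V t)%:C] / D.[s_ j * (V t)%:C]) =
  \sum_(k < l.+1) q`_k * s_ j ^+ k *
    E (fun t => (V t)%:C ^+ k / D.[s_ j * (V t)%:C]).
Proof.
move=> sq.
have e t : q.[s_ j * (V t)%:C] / D.[s_ j * (V t)%:C] =
    \sum_(k < l.+1) q`_k * s_ j ^+ k * ((V t)%:C ^+ k / D.[s_ j * (V t)%:C]).
  rewrite (horner_coef_wide _ sq) mulr_suml; apply: eq_bigr => k _.
  by rewrite exprMn !mulrA.
have i (k : 'I_l.+1) := cintegrableZl (q`_k * s_ j ^+ k)
  (cintegrable_ratio j (ltn_ord k : (k <= l)%N)).
split; first by under [F in cintegrable P F]eq_fun do rewrite e; exact: cintegrable_sum.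
rewrite (eq_cintegral _ e) (cintegral_sum _ i); apply: eq_bigr => k _.
by rewrite (cintegralZl _ (cintegrable_ratio j (ltn_ord k : (k <= l)%N))).
Qed.

(** Reads the unknowns as coefficients of one polynomial q, so that the j-th equation involves only
    q at s_j and the mean of q/D at s_j V. *)
Lemma linear_systemP (w : R) (q : {poly R[i]}) : 0 <= w -> (size q <= l.+1)%N ->
  linear_system N s_ V A w r (fun k => q`_k) <->
  forall j, q.[s_ j] - sysweight j *
      E (fun t => q.[s_ j * (V t)%:C] / D.[s_ j * (V t)%:C]) =
    sysweight j * E (fun t => cexp (- (s_ j * (V t)%:C * w%:C))).
Proof.
move=> w0 sq.
have e j : \sum_(k < l.+1) q`_k * s_ j ^+ k * (1 - sysweight j *
      IV (fun y => y%:C ^+ k / \prod_(m < l) (s_ j * y%:C - s_ m))) =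
    q.[s_ j] - sysweight j *
      E (fun t => q.[s_ j * (V t)%:C] / D.[s_ j * (V t)%:C]).
  have [_ ->] := cintegral_poly_ratio j sq.
  rewrite (horner_coef_wide _ sq) mulr_sumr -sumrB; apply: eq_bigr => k _.
  rewrite IV_ratio; last exact: (ltn_ord k).
  by ring.
by split=> H j; have := H j; rewrite -/(sysweight j) e IV_exp.
Qed.

Section Uniqueness.
Hypothesis s_inj : injective s_.
Hypothesis solvable : forall w : R, 0 <= w -> exists2 q : {poly R[i]},
  (size q <= l.+1)%N & q`_0 = r%:C / (1 - r%:C) * (-1) ^+ l * \prod_(j < l) s_ j /\
  linear_system N s_ V A w r (fun k => q`_k).

Section LeftKernel.
Variable u : 'I_l -> R[i].
Hypothesis hu : forall q : {poly R[i]}, (size q <= l.+1)%N -> q`_0 = 0 ->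
  \sum_j u j * (q.[s_ j] - sysweight j *
    E (fun t => q.[s_ j * (V t)%:C] / D.[s_ j * (V t)%:C])) = 0.

(** The V-part of the left kernel relation: for q with zero constant term, [hu] says that q/D is
    paired to the sum of u_j q(s_j). *)
Definition pairing (f : R[i] -> R[i]) : R[i] :=
  \sum_j u j * (sysweight j * E (fun t => f (s_ j * (V t)%:C))).

(** The solutions for the starting points v and 0 have the same constant term, so [hu] applies to
    their difference; what it says is that the two right-hand sides have equal pairings. *)
Lemma pairing_exp_cst (v : R) : 0 <= v ->
  pairing (fun z => cexp (- (z * v%:C))) = pairing (fun=> 1).
Proof.
move=> v0; have [q sq [q0 qlin]] := solvable v0.
have [p sp [p0 plin]] := solvable (lexx 0).
have sqp : (size (q - p)%R <= l.+1)%N.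
  by rewrite (leq_trans (size_polyD _ _))// size_polyN geq_max sq sp.
have qp0 : (q - p)`_0 = 0 by rewrite coefB q0 p0 subrr.
have := hu sqp qp0; have := (linear_systemP v0 sq).1 qlin.
have := (linear_systemP (lexx 0) sp).1 plin => hp hq.
have e0 : pairing (fun=> 1) = pairing (fun z => cexp (- (z * 0%:C))).
  by apply: eq_bigr => j _; congr (_ * (_ * _)); apply: eq_cintegral => t;
     rewrite mulr0 oppr0 cexp0.
move=> h; apply/eqP; rewrite -subr_eq0 e0 -[X in _ == X]h; apply/eqP.
rewrite /pairing -sumrB; apply: eq_bigr => j _; rewrite -mulrBr; congr (_ * _).
rewrite -hp -hq hornerD hornerN.
have [iq _] := cintegral_poly_ratio j sq; have [ip _] := cintegral_poly_ratio j sp.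
have -> : E (fun t => (q - p).[s_ j * (V t)%:C] / D.[s_ j * (V t)%:C]) =
    E (fun t => q.[s_ j * (V t)%:C] / D.[s_ j * (V t)%:C]) +
    -1 * E (fun t => p.[s_ j * (V t)%:C] / D.[s_ j * (V t)%:C]).
  rewrite -(cintegralZl (-1) ip) -(cintegralD iq (cintegrableZl (-1) ip)).
  by apply: eq_cintegral => t; rewrite hornerD hornerN mulN1r mulrBl.
by ring.
Qed.

(** Pointwise convergence is needed only for Re z > 0 because V < 0 makes Re (s_j V) positive almost
    surely. *)
Lemma pairing_cvg (f_ : nat -> R[i] -> R[i]) (f : R[i] -> R[i]) (C : R) :
  (forall n j, cmeasurable (fun y : R => f_ n (s_ j * y%:C))) ->
  (forall j, cmeasurable (fun y : R => f (s_ j * y%:C))) ->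
  (forall n z, 0 <= complex.Re z -> normc (f_ n z) <= C) ->
  (forall z, 0 < complex.Re z -> cvgC (f_ ^~ z) (f z)) ->
  cvgC (fun n => pairing (f_ n)) (pairing f).
Proof.
move=> mf_ mf fC fcvg; apply: cvgC_sum => j; apply: cvgCZ; apply: cvgCZ.
apply: (@cvg_cintegral _ _ _ _ _ _ C).
- by move=> n; apply: (cmeasurable_comp (mf_ n j)); exact: measurable_RV.
- by apply: (cmeasurable_comp (mf j)); exact: measurable_RV.
- by apply: filterS hV => t Vt n; apply: fC; rewrite Re_negative_pos// ltW.
- by apply: filterS hV => t Vt; apply: fcvg; rewrite ReMr nmulr_rgt0.
Qed.

Let cmeasurable_exp_scale j (x : R[i]) (v : R) :
  cmeasurable (fun y : R => cexp (- ((s_ j * y%:C - x) * v%:C))).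
Proof.
apply: cmeasurable_cexp; apply: cmeasurableN; apply: cmeasurableM.
  by apply: cmeasurableD; [exact: cmeasurable_scale|exact: cmeasurable_cst].
exact: cmeasurable_cst.
Qed.

Lemma pairing1 : pairing (fun=> 1) = 0.
Proof.
have p0 : pairing (fun=> 0) = 0.
  by apply: big1 => j _; rewrite cintegral_cst !mulr0.
(* The form z - 0 lets [cmeasurable_exp_scale] apply with x = 0. *)
have c0 : cvgC (fun n => pairing (fun z => cexp (- ((z - 0) * n.+1%:R%:C)))) 0.
  have := @pairing_cvg (fun n z => cexp (- ((z - 0) * n.+1%:R%:C))) (fun=> 0) 1.
  rewrite p0; apply.
  - by move=> n j; exact: cmeasurable_exp_scale.
  - by move=> j; exact: cmeasurable_cst.
  - by move=> n z z0; apply: normc_cexp_le1; rewrite subr0 Re_Nmul oppr_le0 mulr_ge0.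
  - by move=> z z0; under [X in cvgC X]eq_fun do rewrite subr0; exact: cexp_scale_cvg0.
apply: (cvgC_unique _ c0).
rewrite (_ : (fun n => _) = (fun=> pairing (fun=> 1))); first exact: cvgC_cst.
apply/funext => n; rewrite -(pairing_exp_cst (v := n.+1%:R))//.
by apply: eq_bigr => j _; congr (_ * (_ * _)); apply: eq_cintegral => t; rewrite subr0.
Qed.

(** A finite combination of exponentials e^{-zv} with v >= 0: the factors e^{s_m v} are moved into
    the coefficients [e]. *)
Lemma pairing_expsum n m : pairing (fun z => expsum n (z - s_ m)) = 0.
Proof.
pose e (k : 'I_(n.+1 ^ 2)) : R[i] :=
  n.+1%:R^-1 * cexp (s_ m * (k%:R / n.+1%:R)%:C).
have ve (k : 'I_(n.+1 ^ 2)) : 0 <= k%:R / n.+1%:R :> R by rewrite divr_ge0.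
transitivity (\sum_(k < (n.+1 ^ 2)%N) e k *
    pairing (fun z => cexp (- (z * (k%:R / n.+1%:R)%:C)))); last first.
  by apply: big1 => k _; rewrite pairing_exp_cst// pairing1 mulr0.
under [RHS]eq_bigr do rewrite mulr_sumr.
rewrite exchange_big/=; apply: eq_bigr => j _.
have ie k := cintegrableZl (e k) (cintegrable_exp j (ve k)).
have -> : E (fun t => expsum n (s_ j * (V t)%:C - s_ m)) =
    \sum_(k < (n.+1 ^ 2)%N)
      E (fun t => e k * cexp (- (s_ j * (V t)%:C * (k%:R / n.+1%:R)%:C))).
  rewrite -(cintegral_sum _ ie); apply: eq_cintegral => t.
  rewrite /expsum mulr_sumr; apply: eq_bigr => k _; rewrite /e -[RHS]mulrA -cexpD.
  by congr (_ * cexp _); ring.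
rewrite !mulr_sumr; apply: eq_bigr => k _.
by rewrite (cintegralZl _ (cintegrable_exp j (ve k))); ring.
Qed.

Lemma pairing_inv m : pairing (fun z => (z - s_ m)^-1) = 0.
Proof.
have al0 : 0 < - complex.Re (s_ m) by rewrite oppr_gt0.
have le_Re z : 0 <= complex.Re z -> - complex.Re (s_ m) <= complex.Re (z - s_ m).
  by move=> z0; rewrite ReD ReN lerDr.
have c0 : cvgC (fun n => pairing (fun z => expsum n (z - s_ m)))
    (pairing (fun z => (z - s_ m)^-1)).
  apply: (@pairing_cvg (fun n z => expsum n (z - s_ m)) _
    ((1 + - complex.Re (s_ m)) / - complex.Re (s_ m))).
  - move=> n j; rewrite /expsum; apply: cmeasurableM; first exact: cmeasurable_cst.
    by apply: cmeasurable_sum => k; exact: cmeasurable_exp_scale.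
  - move=> j; apply: cmeasurableV.
    by apply: cmeasurableD; [exact: cmeasurable_scale|exact: cmeasurable_cst].
  - by move=> n z z0; apply: expsum_bound => //; exact: le_Re.
  - move=> z z0; apply: expsum_cvg.
    by rewrite (lt_le_trans al0)// le_Re// ltW.
apply: (cvgC_unique c0); rewrite (_ : (fun n => _) = (fun=> 0)); first exact: cvgC_cst.
by apply/funext => n; exact: pairing_expsum.
Qed.

Lemma left_kernel_eq0 m : u m = 0.
Proof.
(* The factor X provides the zero constant term required by [hu]. *)
pose q : {poly R[i]} := 'X * \prod_(j < l | j != m) ('X - (s_ j)%:P).
have qE z : q.[z] = z * \prod_(j < l | j != m) (z - s_ j).
  by rewrite hornerM hornerX horner_prod; congr (_ * _); apply: eq_bigr => j _;
     rewrite hornerXsubC.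
have sq : (size q <= l.+1)%N.
  rewrite /q mulrC size_mulX; last first.
    by apply/prodf_neq0 => j _; rewrite polyXsubC_eq0.
  rewrite ltnS size_prod; last by move=> j _; rewrite polyXsubC_eq0.
  under eq_bigr do rewrite size_XsubC.
  have l0 : (0 < l)%N by exact: leq_ltn_trans (ltn_ord m).
  by rewrite sum_nat_const cardC1 card_ord muln2 -addnn subSn ?leq_addl// addnK prednK.
have q0 : q`_0 = 0 by rewrite -horner_coef0 qE mul0r.
(* q/D reduces to z/(z - s_m), a combination of two functions that the pairing kills. *)
have ratioE j t : V t < 0 -> q.[s_ j * (V t)%:C] / D.[s_ j * (V t)%:C] =
    1 + s_ m * (s_ j * (V t)%:C - s_ m)^-1.
  move=> Vt; have zpos := Re_negative_pos j (ltW Vt).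
  have := DB_neq0 hs zpos; move: (s_ j * (V t)%:C) zpos => z zpos.
  rewrite qE horner_DB (bigD1 m)//= mulf_eq0 => /norP[z1 z2].
  by field; rewrite z1 z2.
have im j : cintegrable P (fun t => (s_ j * (V t)%:C - s_ m)^-1).
  apply: (@bounded_negative (fun y => (s_ j * y%:C - s_ m)^-1)
    (- complex.Re (s_ m))^-1).
    apply: cmeasurableV.
    by apply: cmeasurableD; [exact: cmeasurable_scale|exact: cmeasurable_cst].
  move=> y y0; have al0 : 0 < - complex.Re (s_ m) by rewrite oppr_gt0.
  have h : - complex.Re (s_ m) <= normc (s_ j * y%:C - s_ m).
    rewrite (le_trans _ (normc_ge_Re _))// (le_trans _ (ler_norm _))//.
    by rewrite ReD ReN lerDr Re_negative_pos.
  by rewrite normcV lef_pV2// posrE (lt_le_trans al0).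
have := hu sq q0.
have -> : \sum_j u j * (q.[s_ j] - sysweight j *
      E (fun t => q.[s_ j * (V t)%:C] / D.[s_ j * (V t)%:C])) =
    u m * q.[s_ m] - (pairing (fun=> 1) + s_ m * pairing (fun z => (z - s_ m)^-1)).
  have -> : u m * q.[s_ m] = \sum_j u j * q.[s_ j].
    rewrite [RHS](bigD1 m)//= [X in _ + X]big1 ?addr0// => j jm.
    by rewrite qE (bigD1 j)//= subrr mul0r !mulr0.
  rewrite mulr_sumr -big_split/= -sumrB; apply: eq_bigr => j _.
  have [iq _] := cintegral_poly_ratio j sq.
  have -> : E (fun t => q.[s_ j * (V t)%:C] / D.[s_ j * (V t)%:C]) =
      E (fun t => 1 + s_ m * (s_ j * (V t)%:C - s_ m)^-1).
    apply: ae_eq_cintegral; first exact: cintegrable_measurable iq.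
      apply: (@cintegrable_measurable _ _ _ P); apply: cintegrableD.
        exact: cintegrable_cst.
      exact: cintegrableZl.
    by apply: filterS hV => t; exact: ratioE.
  rewrite cintegralD; [|exact: cintegrable_cst|exact: cintegrableZl].
  by rewrite cintegralZl//; ring.
(* What is left is u_m q(s_m) = 0, and q(s_m) <> 0 because Re s_m < 0 and the s_j are distinct. *)
rewrite pairing1 pairing_inv mulr0 addr0 subr0 => /eqP.
rewrite mulf_eq0 => /orP[/eqP//|]; rewrite qE mulf_eq0.
have -> : (s_ m == 0) = false.
  by apply/eqP => sm; have := hs m; rewrite sm ltxx.
move=> /= /prodf_eq0[j jm]; rewrite subr_eq0 => /eqP /s_inj mj.
by rewrite mj eqxx in jm.
Qed.

End LeftKernel.

Lemma linear_system_unique (w : R) (a b : 'I_l.+1 -> R[i]) : b ord0 = a ord0 ->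
  linear_system N s_ V A w r a -> linear_system N s_ V A w r b -> b =1 a.
Proof.
move=> ab0 ha hb.
pose IVr j (k : nat) := IV (fun y => y%:C ^+ k / \prod_(m < l) (s_ j * y%:C - s_ m)).
(* Only the columns k = 1, ..., l: prescribing a_0 is what makes the system square. *)
pose M : 'M[R[i]]_l :=
  \matrix_(j, k) (s_ j ^+ k.+1 * (1 - sysweight j * IVr j k.+1)).
have Mfree : row_free M.
  rewrite -kermx_eq0; apply/rowV0P => v /sub_kermxP vM.
  apply/rowP => m; rewrite [RHS]mxE; apply: (@left_kernel_eq0 (fun j => v 0 j)).
  move=> q sq q0.
  (* A polynomial with zero constant term is a combination of the columns of M, all of which v
     kills. *)
  have -> : \sum_j v 0 j * (q.[s_ j] - sysweight j *
      E (fun t => q.[s_ j * (V t)%:C] / D.[s_ j * (V t)%:C])) =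
      \sum_(k < l) q`_k.+1 * (v *m M) 0 k.
    under [RHS]eq_bigr do rewrite mxE mulr_sumr.
    rewrite exchange_big/=; apply: eq_bigr => j _.
    have [_ ->] := cintegral_poly_ratio j sq.
    rewrite (horner_coef_wide _ sq) mulr_sumr -sumrB big_ord_recl q0 !mul0r mulr0 subr0 add0r.
    rewrite mulr_sumr; apply: eq_bigr => k _; rewrite mxE /IVr IV_ratio; last exact: ltn_ord.
    by rewrite /bump/=; ring.
  by apply: big1 => k _; rewrite vM mxE mulr0.
have cM : M *m (\col_k (b (lift ord0 k) - a (lift ord0 k))) = 0.
  apply/colP => j; rewrite !mxE.
  have := ha j; rewrite -(hb j) !big_ord_recl ab0 => /addrI e.
  transitivity (\sum_(i < l) b (lift ord0 i) * s_ j ^+ lift ord0 i *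
      (1 - sysweight j * IVr j (lift ord0 i)) -
    \sum_(i < l) a (lift ord0 i) * s_ j ^+ lift ord0 i *
      (1 - sysweight j * IVr j (lift ord0 i))).
    rewrite -sumrB; apply: eq_bigr => k _; rewrite !mxE /=; ring.
  by apply/eqP; rewrite subr_eq0 eq_sym; exact/eqP.
move=> k; case: (unliftP ord0 k) => [i ->|->//].
move: Mfree; rewrite row_free_unit => Mu.
have := congr1 (fun X => (invmx M *m X) i 0) cM.
rewrite mulmxA mulVmx// mul1mx mulmx0 !mxE => /eqP.
by rewrite subr_eq0 => /eqP.
Qed.

End Uniqueness.

End LinearSystem.

(** * The theorem *)

Section PuncturedNeighborhood.
Variable R : realType.

Lemma near_normc (z : R[i]) (e : R) : 0 < e ->
  \forall s \near (z : R[i]^o), normc (s - z) < e.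
Proof.
move=> e0; apply/(@nbhs_ballP _ R[i]^o); exists e%:C => /=; first by rewrite ltcR.
by move=> s; rewrite /ball/= normrC ltcR normcBC.
Qed.

(** D has finitely many zeros; those different from z keep a positive distance, and z itself is
    excluded by the puncture. *)
Lemma near_dnbhs_DB (l : nat) (s_ : 'I_l -> R[i]) (z : R[i]) :
  \forall s \near (z : R[i]^o)^', (DB s_).[s] != 0.
Proof.
have : \forall s \near (z : R[i]^o)^', forall m, s != s_ m.
  apply: filter_forall => m; have [->|zm] := eqVneq (s_ m) z.
    by rewrite near_withinE; exact: nearW.
  apply: cvg_within.
  have := @near_normc z (normc (s_ m - z)).
  rewrite normc_gt0 subr_eq0 => /(_ zm); apply: filterS => s /= h.
  by apply: contraTneq h => ->; rewrite ltxx.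
apply: filterS => s h; rewrite horner_DB; apply/prodf_neq0 => m _.
by rewrite subr_eq0.
Qed.

End PuncturedNeighborhood.

Theorem theorem5 (d : measure_display) (T : measurableType d) (R : realType)
    (P : probability T R)
    (V A B : nat -> {RV P >-> R}) (w : R)
    (l : nat) (N : {poly R[i]}) (s_ : 'I_l -> R[i])
    (hindep : mutually_independent (inputs V A B))
    (hidV : identically_distributed V)
    (hidA : identically_distributed A)
    (hidB : identically_distributed B)
    (hA : {ae P, forall t, 0 <= A 0%N t})
    (hB : {ae P, forall t, 0 <= B 0%N t})
    (hVint : P.-integrable setT (fun t => (V 0%N t)%:E))
    (hYint : P.-integrable setT (fun t => (B 0%N t - A 0%N t)%:E))
    (hw : 0 <= w)
    (hV : {ae P, forall t, V 0%N t < 0})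
    (hs : forall j, complex.Re (s_ j) < 0)
    (hN : (size N <= l)%N)
    (hND : forall z : R[i], ~ (root N z /\ root (DB s_) z))
    (hBrat : forall s : R[i], 0 <= complex.Re s ->
      LST P (B 0%N) s = N.[s] / (DB s_).[s])
    (r : R) (hr : 0 < r < 1) :
  exists a : 'I_l.+1 -> R[i],
    [/\ a ord0 = r%:C / (1 - r%:C) * (-1) ^+ l * \prod_(j < l) s_ j,
      forall s : R[i], 0 <= complex.Re s ->
        U P (W w V A B) r s =
        cexp (- (s * w%:C)) + (\sum_(k < l.+1) a k * s ^+ k) / (DB s_).[s],
      (forall s : R[i], complex.Re s <= 0 -> (DB s_).[s] != 0 ->
        U P (Wstar w V A B) r s =
        Wstar_transform N s_ (V 0%N) (A 0%N) (U P (W w V A B) r) r a s) /\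
      (forall j : 'I_l,
        (Wstar_transform N s_ (V 0%N) (A 0%N) (U P (W w V A B) r) r a s : R[i]^o)
          @[s --> (s_ j : R[i]^o)^'] --> (U P (Wstar w V A B) r (s_ j) : R[i]^o)),
      linear_system N s_ (V 0%N) (A 0%N) w r a &
      injective s_ -> forall b : 'I_l.+1 -> R[i],
        b ord0 = a ord0 -> linear_system N s_ (V 0%N) (A 0%N) w r b -> b =1 a].
Proof.
have [r0 r1] := andP hr.
have rC0 : r%:C != 0 by rewrite -normc_gt0 normcR gtr0_norm.
(* Needed for every starting point v, not only w: uniqueness draws its exponential test functions
   from all of them. *)
have lin (v : R) : 0 <= v -> linear_system N s_ (V 0%N) (A 0%N) v r
    (Ucoef V A B s_ r v).
  move=> v0; apply/(linear_systemP _ _ hV hs _ v0 (size_interp _ _)) => j.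
  have sj := ltW (hs j).
  have := UWstar_equation hindep hidV hidA hidB hA hB hV hs hN hBrat hr v0 sj.
  have [iU ->] := IV_UW hindep hidV hidA hidB hA hB hV hs hN hBrat hr v0 sj.
  (* At s_j the term with U of Wstar carries the factor D(s_j) = 0 and disappears. *)
  rewrite root_DB mul0r add0r.
  have [iq _] := cintegral_poly_ratio hV hs j (size_interp l
    (fun z => (DB s_).[z] * (U P (W v V A B) r z - cexp (- (z * v%:C))))).
  rewrite (cintegralD (cintegrable_exp hV hs j v0) iq) => e.
  have -> : (UWpoly V A B s_ r v).[s_ j] = r%:C * (r%:C^-1 * (UWpoly V A B s_ r v).[s_ j]).
    by rewrite mulrA divff// mul1r.
  by rewrite -e /sysweight; ring.
have star s : complex.Re s <= 0 -> (DB s_).[s] != 0 ->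
    U P (Wstar w V A B) r s =
    Wstar_transform N s_ (V 0%N) (A 0%N) (U P (W w V A B) r) r (Ucoef V A B s_ r w) s.
  move=> s0 D0; rewrite /Wstar_transform Ucoef_sum /PhiY.
  have := UWstar_equation hindep hidV hidA hidB hA hB hV hs hN hBrat hr hw s0.
  move: (cintegral _ _ _) (U P (Wstar w V A B) r s) (UWpoly _ _ _ _ _ _).[s].
  move: (1 - r%:C)^-1 (LST _ _ _) N.[s] (DB s_).[s] D0 => c L n D D0 I u p e.
  have -> : p = r%:C * (D * (c - u) + n * L * I) by rewrite e mulrA divff// mul1r.
  by field; rewrite rC0 D0.
exists (Ucoef V A B s_ r w); split.
- exact: (Ucoef0 hindep hidV hidA hidB hA hB hV hs hN hBrat hr hw).
- move=> s s0; rewrite Ucoef_sum.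
  exact: (UW_E hindep hidV hidA hidB hA hB hV hs hN hBrat hr hw).
(* By [star] the formula equals U of Wstar near s_j off the zeros of D, so the limit reduces to
   continuity of U of Wstar at s_j. *)
- split=> // j; apply/(@cvgrPdist_lt _ R[i]^o) => -[e ei].
  rewrite ltcE/= => /andP[/eqP -> e0].
  (* The disc of radius del/2 about s_j stays in Re s <= 0. The constant K combines 12/del from
     [LST_lipschitz] with 2/(1 - r) from [U_lipschitz]. *)
  pose del := - complex.Re (s_ j); have del0 : 0 < del by rewrite oppr_gt0.
  pose K := 2 * (12 / del) / (1 - r).
  have K0 : 0 < K by rewrite divr_gt0 ?subr_gt0// mulr_gt0// divr_gt0.
  near=> s.
  have s1 : normc (s - s_ j) < del / 2.
    by near: s; apply: cvg_within; apply: near_normc; rewrite divr_gt0.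
  have s2 : normc (s - s_ j) < e / K.
    by near: s; apply: cvg_within; apply: near_normc; rewrite divr_gt0.
  have D0 : (DB s_).[s] != 0 by near: s; exact: near_dnbhs_DB.
  have s0 : complex.Re s <= 0.
    have := le_lt_trans (le_trans (ler_norm _) (normc_ge_Re (s - s_ j))) s1.
    by rewrite ReD ReN /del; have := hs j; lra.
  rewrite -star// normrC ltcR normcBC.
  have := @U_lipschitz _ _ hr _ _ P (Wstar w V A B) s (s_ j) 2
    (fun i => bounded_LST_Wstar V A B w i s0)
    (fun i => bounded_LST_Wstar V A B w i (ltW (hs j)))
    (12 / del * normc (s - s_ j)).
  have lip i : normc (LST P (Wstar w V A B i) s - LST P (Wstar w V A B i) (s_ j)) <=
      12 / del * normc (s - s_ j).
    apply: LST_lipschitz => //.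
    + exact: measurable_Wstar.
    + by move=> t; exact: Wstar_le0.
    + by rewrite /del opprK.
    + exact: ltW.
  move=> /(_ lip) /le_lt_trans; apply.
  rewrite (_ : 2 * _ / _ = K * normc (s - s_ j)); last by rewrite /K; ring.
  by rewrite mulrC -ltr_pdivlMr.
- exact: lin.
- move=> s_inj b b0; apply: (linear_system_unique hV hs s_inj _ b0 (lin w hw)).
  move=> v v0; exists (UWpoly V A B s_ r v); first exact: size_interp.
  split; last exact: lin.
  exact: (Ucoef0 hindep hidV hidA hidB hA hB hV hs hN hBrat hr v0).
Unshelve. all: by end_near. Qed.
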